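(* Consider a control system $\dot x=f(x,u)$ with state-space $M$, a closed finite-dimensional smooth manifold, and control space $U$, a finite-dimensional smooth manifold, and let $x^*\in M$. Then $x^*$ is weakly $1$-point almost globally stabilizable by dynamic feedback, or strongly $1$-point almost globally stabilizable by dynamic feedback, only if the closed-loop system has a total space $E$ which is a nontrivial bundle.
   Context: The state-space $M$, the control space $U$ and the total space $E$ of a feedback system are finite-dimensional smooth manifolds and CW complexes. Closed means compact without boundary. The map $f:M\times U\to TM$ is a smooth $u$-dependent vector field, i.e. $f(x,u)\in T_xM$ for all $u\in U$. A smooth fibre bundle $p:E\to M$ with fibre $U$ consists of smooth manifolds $E,M,U$ and a smooth projection map $p$ from $E$ onto $M$ such that for every $x\in M$ there are an open neighborhood $V_x$ of $x$ and a diffeomorphism $\varphi_x:p^{-1}(V_x)\to V_x\times U$ (a local trivialization) with $p_1\circ\varphi_x=p$ on $p^{-1}(V_x)$, where $p_1$ is the projection onto the first component. The bundle is trivial if one can take $V_x=M$, so that $E$ is diffeomorphic to $M\times U$ via $\varphi_x$; otherwise it is nontrivial. A dynamic feedback for $f$ is a smooth fibre bundle $p:E\to M$ with fibre $U$ together with a vector field $f_{cl}$ on $E$ (the closed-loop system, with total space $E$) which, using the local trivializations $\varphi_x$, can be written as $\dot x=f(x,u)$, $\dot u=g(x,u)$. Stability: for a vector field $F$ on a manifold $X$, with $e^{tF}y$ the solution at time $t$ initialized at $y$, an equilibrium $y^*$ is Lyapunov stable if for every neighborhood $V_1$ of $y^*$ there is a neighborhood $V_2$ of $y^*$ such that $y\in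 V_2$ implies $e^{tF}y\in V_1$ for $t\ge 0$. It is globally asymptotically stable if moreover $\lim_{t\to\infty}e^{tF}y=y^*$ for all $y\in X$. The definition extends to a submanifold $N\subseteq X$ in place of $y^*$ (using neighborhoods of $N$ and convergence of trajectories to $N$). A dynamic feedback strongly (resp. weakly) $1$-point almost globally stabilizes $x^*$ if there exists one point $z_1\in E$ such that some $z^*\in p^{-1}(x^* )$ (resp. the fibre $p^{-1}(x^* )$) is globally asymptotically stable for $f_{cl}$ over $E-\{z_1\}$. The point $x^*$ is strongly (resp. weakly) $1$-point almost globally stabilizable by dynamic feedback if such a dynamic feedback exists; the theorem says that the bundle $p:E\to M$ of any such dynamic feedback is nontrivial.
   Formalization: The formal theorem also assumes that the state-space M has a point other than x* and that the control space U has at least two points; if M or U is a single point the claim fails (e.g. the north-south field on a sphere, with trivial bundle). *)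

(* Defs.v *)
From HB Require Import structures.
From mathcomp Require Export all_boot all_order all_algebra.
From mathcomp Require Export all_classical all_reals all_analysis.
Export numFieldNormedType.Exports.
Set Implicit Arguments.
Unset Strict Implicit.
Unset Printing Implicit Defensive.
Import Order.TTheory GRing.Theory Num.Theory.
Local Open Scope classical_set_scope.
Local Open Scope ring_scope.

(* [f] is of class C^k on the open set [D].  The codomain is meant to be
   finite-dimensional, as is the domain, so that continuity of all iterated
   directional derivatives amounts to continuity of the iterated
   differentials. *)
Fixpoint classC (R : realType) (V W : normedModType R) (k : nat) (D : set V)
    (f : V -> W) : Prop :=
  match k with
  | 0%N => forall x, D x -> {for x, continuous f}
  | k'.+1 => (forall x, D x -> differentiable f x) /\
             (forall v : V, classC k' D (fun x => 'D_v f x))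
  end.

Definition classCinf (R : realType) (V W : normedModType R) (D : set V)
    (f : V -> W) : Prop := forall k, classC k D f.

(* A chart with values in R^n.  [cmap] is only meaningful on [cdom], and [cinv]
   only on the image of [cdom]. *)
Record chart (R : realType) (T : topologicalType) (n : nat) := Chart {
  cdom : set T;
  cmap :> T -> 'rV[R]_n;
  cinv : 'rV[R]_n -> T }.

Record is_chart (R : realType) (T : topologicalType) (n : nat)
    (c : chart R T n) : Prop := IsChart {
  chart_open_dom : open (cdom c);
  chart_open_img : open (c @` cdom c);
  chartK : forall x, cdom c x -> cinv c (c x) = x;
  chart_continuous : forall x, cdom c x -> {for x, continuous c};
  chart_inv_continuous :
    forall v, (c @` cdom c) v -> {for v, continuous (cinv c)} }.

(* The data of a manifold, its axioms being [smooth_manifold] below.  The atlas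
   need not be maximal. *)
Record chartedSpace (R : realType) := ChartedSpace {
  carrier :> topologicalType;
  dim : nat;
  atlas : set (chart R carrier dim) }.
Arguments atlas {R} X _ : rename.

(* Charts take values in open subsets of R^n: there is no boundary. *)
Record smooth_manifold (R : realType) (X : chartedSpace R) : Prop :=
  SmoothManifold {
  manifold_hausdorff : hausdorff_space X;
  manifold_second_countable : @second_countable X;
  manifold_charts : forall c, atlas X c -> is_chart c;
  manifold_cover : forall x : X, exists2 c, atlas X c & cdom c x;
  manifold_compat : forall c d, atlas X c -> atlas X d ->
    classCinf (c @` (cdom c `&` cdom d)) (d \o cinv c) }.

Definition euclidean (R : realType) (n : nat) : chartedSpace R :=
  @ChartedSpace R 'rV[R]_n n [set Chart setT id id].

Definition prod_chart (R : realType) (X Y : topologicalType) (m n : nat)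
    (c : chart R X m) (d : chart R Y n) : chart R (X * Y)%type (m + n) :=
  Chart (cdom c `*` cdom d)
        (fun z => row_mx (c z.1) (d z.2))
        (fun v => (cinv c (lsubmx v), cinv d (rsubmx v))).

Definition prod_manifold (R : realType) (X Y : chartedSpace R) :
    chartedSpace R :=
  @ChartedSpace R (X * Y)%type (dim X + dim Y)
    [set e | exists c d,
      [/\ atlas X c, atlas Y d & e = prod_chart c d]].

(* Smoothness on an open set [D]; nothing is said about [h] outside [D]. *)
Definition smooth_on (R : realType) (X Y : chartedSpace R) (D : set X)
    (h : X -> Y) : Prop :=
  (forall x, D x -> {for x, continuous h}) /\
  (forall c d, atlas X c -> atlas Y d ->
    classCinf (c @` (cdom c `&` D `&` h @^-1` cdom d)) (d \o h \o cinv c)).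

(* [h] restricts to a diffeomorphism from the open set [A] onto the open set
   [B]. *)
Definition diffeo_on (R : realType) (X Y : chartedSpace R) (A : set X)
    (B : set Y) (h : X -> Y) : Prop :=
  exists k : Y -> X,
    [/\ smooth_on A h /\ smooth_on B k,
        forall x, A x -> B (h x),
        forall y, B y -> A (k y),
        forall x, A x -> k (h x) = x &
        forall y, B y -> h (k y) = y].

(* A tangent vector at [x] is the family of its coordinate vectors in all
   charts around [x], any two of them being related by the differential of the
   transition map.  The values of [coord] at other charts are irrelevant. *)
Record tangent (R : realType) (X : chartedSpace R) (x : X) := Tangent {
  coord : chart R X (dim X) -> 'rV[R]_(dim X);
  coordE : forall c d, atlas X c -> atlas X d ->
    cdom c x -> cdom d x ->
    coord d = 'D_(coord c) (d \o cinv c) (c x) }.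

(* [dh_x (v) = w] for a map [h] that is smooth around [x]. *)
Definition tangent_map (R : realType) (X Y : chartedSpace R) (h : X -> Y)
    (x : X) (v : tangent x) (w : tangent (h x)) : Prop :=
  forall c d, atlas X c -> atlas Y d ->
    cdom c x -> cdom d (h x) ->
    coord w d = 'D_(coord v c) (d \o h \o cinv c) (c x).

(* Smoothness on the open set [D] of a section [s] of [TX] along a smooth map
   [h : Z -> X], that is of a map [s : Z -> TX] with [s z \in T_{h z} X].
   A vector field on [X] is the case [h = id]. *)
Definition smooth_along (R : realType) (Z X : chartedSpace R) (D : set Z)
    (h : Z -> X) (s : forall z, tangent (h z)) : Prop :=
  forall c, atlas X c ->
    @smooth_on R Z (euclidean R (dim X)) (D `&` h @^-1` cdom c)
      (fun z => coord (s z) c).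

Definition trivialization (R : realType) (E M U : chartedSpace R) (p : E -> M)
    (V : set M) (phi : E -> M * U) : Prop :=
  [/\ open V,
      @diffeo_on R E (prod_manifold M U) (p @^-1` V) (V `*` setT) phi &
      forall z, V (p z) -> (phi z).1 = p z].

Record fibre_bundle (R : realType) (E M U : chartedSpace R) (p : E -> M) :
    Prop := FibreBundle {
  bundle_total : smooth_manifold E;
  bundle_base : smooth_manifold M;
  bundle_fibre : smooth_manifold U;
  bundle_smooth : smooth_on setT p;
  bundle_onto : forall x, exists z, p z = x;
  bundle_local : forall x, exists V (phi : E -> M * U),
    V x /\ trivialization p V phi }.

Definition trivial_bundle (R : realType) (E M U : chartedSpace R)
    (p : E -> M) : Prop :=
  exists phi : E -> M * U, trivialization p setT phi.

Definition control_system (R : realType) (M U : chartedSpace R)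
    (f : forall xu : M * U, tangent xu.1) : Prop :=
  @smooth_along R (prod_manifold M U) M setT fst f.

(* In the trivializations of [feedback_local] the closed-loop vector field is
   the pair [(f, g)]: its image under the differential of [phi] has components
   [f (x, u)] and [g (x, u)] at [phi z = (x, u)].  The map [g] depends on the
   trivialization. *)
Record dynamic_feedback (R : realType) (M U : chartedSpace R)
    (f : forall xu : M * U, tangent xu.1) := DynamicFeedback {
  total : chartedSpace R;
  proj : total -> M;
  closed_loop : forall z : total, tangent z;
  feedback_bundle : fibre_bundle U proj;
  feedback_smooth : @smooth_along R total total setT id closed_loop;
  feedback_local : forall x, exists V (phi : total -> M * U),
    [/\ V x,
        trivialization proj V phi &
        exists2 g : (forall xu : M * U, tangent xu.2),
          @smooth_along R (prod_manifold M U) U (V `*` setT) snd g &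
          forall z, V (proj z) ->
            @tangent_map R total M (fst \o phi) z (closed_loop z) (f (phi z))
            /\
            @tangent_map R total U (snd \o phi) z (closed_loop z) (g (phi z))]
  }.
Arguments proj {R M U f} d _.
Arguments closed_loop {R M U f} d z.

Definition integral_curve_at (R : realType) (X : chartedSpace R)
    (F : forall x : X, tangent x) (gamma : R -> X) (t : R) : Prop :=
  {for t, continuous gamma} /\
  forall c, atlas X c -> cdom c (gamma t) ->
    is_derive t 1 (c \o gamma) (coord (F (gamma t)) c).

(* [Phi t y = e^{tF} y] on the subset [A], for [t >= 0]: solutions starting in
   [A] exist for all nonnegative times and remain in [A].  The values of [Phi]
   for [t < 0] or [y] outside [A] are irrelevant, except that a solution is
   required to have a two-sided derivative at [0], which can always be
   achieved. *)
Definition semiflow_on (R : realType) (X : chartedSpace R)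
    (F : forall x : X, tangent x) (A : set X) (Phi : R -> X -> X) : Prop :=
  forall y, A y -> Phi 0 y = y /\
    forall t, 0 <= t -> A (Phi t y) /\ integral_curve_at F (Phi ^~ y) t.

(* Neighbourhoods of [N] relative to [A] are the traces on [A] of
   neighbourhoods of [N] in [X]. *)
Definition lyapunov_stable (R : realType) (X : chartedSpace R) (A N : set X)
    (Phi : R -> X -> X) : Prop :=
  forall V1, set_nbhs N V1 -> exists2 V2, set_nbhs N V2 &
    forall y t, A y -> V2 y -> 0 <= t -> V1 (Phi t y).

(* Convergence to [N] means being eventually in every neighbourhood of [N]. *)
Definition attractive (R : realType) (X : chartedSpace R) (A N : set X)
    (Phi : R -> X -> X) : Prop :=
  forall y, A y -> forall V, set_nbhs N V -> \forall t \near +oo, V (Phi t y).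

(* [N] is globally asymptotically stable for the restriction of [F] to the
   open submanifold [A]. *)
Definition globally_asymptotically_stable (R : realType) (X : chartedSpace R)
    (F : forall x : X, tangent x) (A N : set X) : Prop :=
  N `<=` A /\
  exists Phi : R -> X -> X,
    [/\ semiflow_on F A Phi, lyapunov_stable A N Phi & attractive A N Phi].

Definition equilibrium (R : realType) (X : chartedSpace R)
    (F : forall x : X, tangent x) (x : X) : Prop :=
  forall c, atlas X c -> cdom c x -> coord (F x) c = 0.

Definition strongly_one_point_ag_stabilizes (R : realType)
    (M U : chartedSpace R) (f : forall xu : M * U, tangent xu.1)
    (D : dynamic_feedback f) (xs : M) : Prop :=
  exists z1 zs : total D,
    [/\ proj D zs = xs, equilibrium (closed_loop D) zs &
        globally_asymptotically_stable (closed_loop D)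
          (~` [set z1]) [set zs]].

Definition weakly_one_point_ag_stabilizes (R : realType)
    (M U : chartedSpace R) (f : forall xu : M * U, tangent xu.1)
    (D : dynamic_feedback f) (xs : M) : Prop :=
  exists z1 : total D,
    globally_asymptotically_stable (closed_loop D)
      (~` [set z1]) (proj D @^-1` [set xs]).

(* Main.v *)
Require Import Defs.
From mathcomp Require Import zify ring lra.
(* If the bundle were trivial, a slice M x {u} avoiding the removed point z1
   would be a section of the projection E -> M inside the basin of attraction.
   By compactness of M, the flow carries the slice in finite time T into the
   part of E lying over a ball around xs; projecting this motion to M and then
   contracting the ball shows that M is contractible.  A closed manifold with
   more than one point is not contractible, for the following reason.

   Let H be a contraction of M.  It extends paths in charts to a way of joining
   any two points, which yields a retraction of some R^N onto M; so every map
   M -> M has a fixed point, by Brouwer's theorem.  On the other hand, if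
   dim M > 0, a constant map is approximated by other maps with which it has no
   coincidence, and this property can be transported backwards along H, in
   small steps that are translations in charts, to the identity; so some map
   M -> M has no fixed point.

   Brouwer's theorem is deduced from Scarf's combinatorial lemma, and the
   continuity and the semigroup property of the flow from Gronwall's
   inequality in charts. *)

(** No homology or degree is used: a contractible closed manifold of positive dimension is excluded
    by two elementary statements, one forcing fixed points and one producing a map without any. In
    Brouwer's theorem, triangulations are replaced by linear orders on grid points. In the
    retraction, the contraction [H] does the work of a metric or of a tubular neighbourhood: outside
    a cell, where segments in coordinates are meaningless, everything is first squeezed to [x0]. The
    property carried along [H] speaks of arbitrarily close approximations rather than of a single
    map, because a translation in a chart is injective only inside the chart, so that coincidences
    are excluded only for maps that stay near the given one. The radii of a cell are nested
    accordingly: the balls of radius 1/2 cover, moves start within radius 1, and coordinates are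
    faithful up to radius 2. *)

Set Implicit Arguments.
Unset Strict Implicit.
Unset Printing Implicit Defensive.
Import Order.TTheory GRing.Theory Num.Theory.

(** * Scarf's lemma *)

Section Dominant.
Variables (I V : finType) (rk : I -> V -> nat).
Hypothesis rk_inj : forall i, injective (rk i).
Implicit Types (D Z : {set V}) (i j : I) (v w x y z : V).

Definition lowest D i v := (v \in D) && [forall z in D, rk i v <= rk i z].

(** For nonempty [D]: no element exceeds the minima of [D] in all orders at once. Such a [D]
    consists of its minima, so it has at most as many elements as there are orders. *)
Definition dominant D := [forall y, exists i, forall z in D, rk i y <= rk i z].

Lemma dominantP D :
  reflect (forall y, exists i, forall z, z \in D -> rk i y <= rk i z)
    (dominant D).
Proof.
apply: (iffP forallP) => H y.
  by have /existsP[i /forall_inP Hi] := H y; exists i.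
by have [i Hi] := H y; apply/existsP; exists i; apply/forall_inP.
Qed.

Lemma lowestP D i v :
  reflect (v \in D /\ forall z, z \in D -> rk i v <= rk i z) (lowest D i v).
Proof.
by apply: (iffP andP) => -[vD H]; split=> //; apply/forall_inP.
Qed.

Lemma lowest_uniq D i v w : lowest D i v -> lowest D i w -> v = w.
Proof.
move=> /lowestP[vD vm] /lowestP[wD wm]; apply: (@rk_inj i).
by apply/eqP; rewrite eqn_leq vm ?wm.
Qed.

Lemma lowest_fun D :
  D != finset.set0 -> exists m : I -> V, forall i, lowest D i (m i).
Proof.
move=> /finset.set0Pn[v0 v0D].
exists (fun i => [arg min_(v < v0 in D) rk i v]) => i.
by case: arg_minnP => // v vD vm; apply/lowestP.
Qed.

Lemma dominant_onto D (m : I -> V) :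
  (forall i, lowest D i (m i)) -> dominant D -> m @: I = D.
Proof.
move=> mD /dominantP dD; apply/setP => v; apply/imsetP/idP => [[i _ ->]|vD].
  by have /lowestP[] := mD i.
have [i Hi] := dD v; exists i => //; apply: lowest_uniq (mD i).
exact/lowestP.
Qed.

Lemma dominant_sub D Z : D \subset Z -> dominant Z -> dominant D.
Proof.
move=> /fintype.subsetP DZ /dominantP H; apply/dominantP => y;
  have [i Hi] := H y.
by exists i => z /DZ/Hi.
Qed.

Section Door.
Variables (D : {set V}) (m : I -> V).
Hypotheses (mD : forall i, lowest D i (m i)) (domD : dominant D).

(** The elements that can join [D] without disturbing its minima in the orders other than [j]. *)
Definition above j := [set y | [forall i, (i != j) ==> (rk i (m i) < rk i y)]].

Lemma aboveP j y :
  reflect (forall i, i != j -> rk i (m i) < rk i y) (y \in above j).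
Proof.
by rewrite inE; apply: (iffP forallP) => H i; apply/implyP; apply: H.
Qed.

Definition top_above j x :=
  (x \in above j) && [forall y in above j, rk j y <= rk j x].

Lemma top_aboveP j x :
  reflect (x \in above j /\ forall y, y \in above j -> rk j y <= rk j x)
    (top_above j x).
Proof. by apply: (iffP andP) => -[xj H]; split=> //; apply/forall_inP. Qed.

Lemma card_top_above j : #|[set x | top_above j x]| = (above j != finset.set0).
Proof.
have [j0|/finset.set0Pn[y yj]] /= := eqVneq (above j) finset.set0.
  by apply: eq_card0 => x; rewrite inE /top_above j0 finset.in_set0.
suff [x xj] : exists x, top_above j x.
  apply/eqP/cards1P; exists x; apply/setP => z; rewrite inE finset.in_set1.
  apply/idP/eqP => [|->//] /top_aboveP[zj zt]; move/top_aboveP: xj => [xj xt].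
  by apply: (@rk_inj j); apply/eqP; rewrite eqn_leq zt // xt.
have [] := @arg_maxnP _ y (mem (above j)) (rk j) yj => x xj xt.
by exists x; apply/top_aboveP; split=> // z /xt.
Qed.

Hypothesis cardD : #|D|.+1 = #|I|.

Lemma imset_setD1 j (f : I -> V) i : i != j -> f i = f j ->
  f @: [set~ j] = f @: I.
Proof.
move=> ij fij; apply/setP => v; apply/imsetP/imsetP => -[k kj ->];
  first by exists k.
have [->|kj'] := eqVneq k j; last by exists k; rewrite ?finset.in_setC1.
by exists i; rewrite ?finset.in_setC1.
Qed.

(** [m] maps [I] onto [D], which has one element less, so exactly one element is the minimum in two
    orders. Only these two orders can pass their minimum to a new element. *)
Lemma door_lowest : exists j1 j2, [/\ j1 != j2, m @: [set~ j1] = D,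
  m @: [set~ j2] = D & forall j, m @: [set~ j] = D -> j = j1 \/ j = j2].
Proof.
have mI := dominant_onto mD domD.
have [j1 [j2 [j12 mj]]] : exists j1 j2, j1 != j2 /\ m j1 = m j2.
  have /injectiveP : ~ injective m.
    move=> /card_imset-/(_ I); rewrite mI => DI.
    by move: cardD; rewrite DI => /eqP; rewrite eqn_leq ltnn.
  by move=> /injectivePn[x [y xy mxy]]; exists x, y.
exists j1, j2; split=> //.
- by rewrite (imset_setD1 _ (esym mj)) // eq_sym.
- by rewrite (imset_setD1 _ mj).
move=> j mjD.
have inj : {in [set~ j] &, injective m}.
  apply/imset_injP; rewrite mjD cardsC1.
  by move: cardD => <-.
have [->|j1j] := eqVneq j1 j; first by left.
have [->|j2j] := eqVneq j2 j; first by right.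
by case/eqP: j12; apply: inj => //; rewrite finset.in_setC1.
Qed.

(** The new element [x] becomes the minimum in order [j]. For [y] in [above j], dominance of [D] can
    only come from the order [j], in which [x] is also at least [y]. Any other [y] is at most some
    [m i] with [i != j], hence below [x] in that order. *)
Lemma lowest_new j x : m @: [set~ j] = D -> top_above j x ->
  x \notin D /\ dominant (x |: D).
Proof.
move=> mj /top_aboveP[/aboveP xj xt]; split.
  rewrite -mj; apply/imsetP => -[i]; rewrite finset.in_setC1 => ij xi.
  by have := xj i ij; rewrite xi ltnn.
apply/dominantP => y.
have [yj|] := boolP (y \in above j).
  exists j => z; rewrite finset.in_setU1 => /predU1P[->|]; first exact: xt.
  have /dominantP/(_ y)[i Hi] := domD.
  suff <- : i = j by exact: Hi.
  apply: contraTeq yj => ij; apply/aboveP => /(_ i ij).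
  by have /lowestP[miD _] := mD i; rewrite ltnNge Hi.
move=> /aboveP; rewrite -existsNE => -[i /not_implyP[ij /negP]].
rewrite -leqNgt => yi; exists i => z; rewrite finset.in_setU1 =>
  /predU1P[->|zD].
  by apply: leq_trans yi _; apply/ltnW/xj.
by have /lowestP[_ /(_ _ zD)] := mD i; apply: leq_trans yi.
Qed.

Lemma new_lowest x : x \notin D -> dominant (x |: D) ->
  exists2 j, m @: [set~ j] = D & top_above j x.
Proof.
move=> xD domxD.
have [|m' m'D] := @lowest_fun (x |: D).
  by apply/finset.set0Pn; exists x; rewrite finset.setU11.
have m'I := dominant_onto m'D domxD.
have m'inj : injective m'.
  have : #|m' @: I| == #|I| by rewrite m'I cardsU1 xD add1n cardD.
  by move=> /imset_injP H a b; apply: H.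
have : x \in m' @: I by rewrite m'I finset.setU11.
case/imsetP => j _ xj.
have m'm i : i != j -> m' i = m i.
  move=> ij; have /lowestP[+ m'i] := m'D i.
  rewrite finset.in_setU1 => /predU1P[|m'iD].
    by rewrite xj => /m'inj ij'; rewrite ij' eqxx in ij.
  apply: lowest_uniq (mD i); apply/lowestP; split=> // z zD.
  by apply: m'i; rewrite finset.in_setU1 zD orbT.
have mj : m @: [set~ j] = D.
  apply/eqP; rewrite eqEcard; apply/andP; split.
    by apply/fintype.subsetP => _ /imsetP[i _ ->]; have /lowestP[] := mD i.
  rewrite card_in_imset ?cardsC1 -?cardD //.
  move=> a b; rewrite !finset.in_setC1 => aj bj; rewrite -!m'm //; exact: m'inj.
exists j => //; apply/top_aboveP.
have xab : x \in above j.
  apply/aboveP => i ij; have /lowestP[_ m'i] := m'D i.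
  rewrite -(m'm i ij) ltn_neqAle m'i ?finset.setU11 // andbT.
  by apply: contraNneq ij => /(@rk_inj i); rewrite xj => /m'inj ->.
split=> // y /aboveP yab.
have /dominantP/(_ y)[i Hi] := domxD.
suff <- : i = j by rewrite Hi ?finset.setU11.
have [//|ij] := eqVneq i j.
have := yab i ij; rewrite ltnNge Hi // finset.in_setU1.
by have /lowestP[-> _] := mD i; rewrite orbT.
Qed.

(** Each of the two orders sharing a minimum admits at most one new element. The two new elements
    differ: a common one would exceed the minima in all orders, against the dominance of [D]. *)
Lemma card_rooms : exists j1 j2, [/\ m @: [set~ j1] = D, m @: [set~ j2] = D,
  j1 != j2 &
  #|[set x | (x \notin D) && dominant (x |: D)]| =
  (above j1 != finset.set0) + (above j2 != finset.set0)].
Proof.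
have [j1 [j2 [j12 mj1 mj2 mj]]] := door_lowest.
exists j1, j2; split=> //.
rewrite -!card_top_above -cardsUI.
rewrite [X in _ = _ + #|pred_of_set X|](_ : _ = finset.set0); last first.
  apply/setP => x; rewrite !inE; apply/negP.
  move=> /andP[/top_aboveP[/aboveP x1 _] /top_aboveP[/aboveP x2 _]].
  have /dominantP/(_ x)[i Hi] := domD.
  have /lowestP[miD _] := mD i.
  have := Hi _ miD; rewrite leqNgt => /negP; apply.
  by have [ij|] := eqVneq i j1; [apply: x2; rewrite ij|apply: x1].
rewrite cards0 addn0; apply: eq_card => x; rewrite !inE.
apply/andP/orP => [[xD domx]|[]xt].
- by have [j /mj[]-> ?] := new_lowest xD domx; [left|right].
- exact: lowest_new xt.
- exact: lowest_new xt.
Qed.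

End Door.

End Dominant.

Section ScarfParity.
Variables (I V : finType) (rk : I -> V -> nat) (c : V -> I) (i0 : I).
Hypothesis rk_inj : forall i, injective (rk i).
Hypothesis rooms_not_full : forall Z : {set V},
  #|Z| = #|I| -> dominant rk Z -> c @: Z != [set: I].

(* Counting incidences modulo 2: a door lies in exactly two rooms, unless it is
   the outer one, which lies in one; and a room in which not all colours occur
   contains no door or two. *)
Definition room (Z : {set V}) := (#|Z| == #|I|) && dominant rk Z.
Definition door (D : {set V}) :=
  [&& #|D|.+1 == #|I|, dominant rk D & c @: D == [set~ i0]].

(** If [Z] is a door [D0] plus a point [z0], then [D0] has each colour other than [i0] exactly once,
    and [z0] repeats the colour of a unique [z1] in [D0]. The doors in [Z] arise by removing [z0] or
    [z1]. *)
Lemma even_doors Z : room Z -> ~~ odd #|[set D | door D && (D \subset Z)]|.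
Proof.
move=> /andP[/eqP cZ domZ].
have [->|/finset.set0Pn[D0]] := eqVneq [set D | door D && (D \subset Z)]
  finset.set0.
  by rewrite cards0.
rewrite inE => /andP[/and3P[/eqP cD0 domD0 /eqP cD0i] D0Z].
have injD0 : {in D0 &, injective c}.
  by apply/imset_injP; rewrite cD0i cardsC1 -cD0.
have [z0 z0D0 ZE] : exists2 z0, z0 \notin D0 & Z = z0 |: D0.
  have : #|Z :\: D0| == 1.
    by rewrite cardsDS // cZ -cD0 subSnn.
  move=> /cards1P[z0 ZD0]; exists z0.
    by have := finset.set11 z0; rewrite -ZD0 inE; case/andP.
  by rewrite -ZD0 finset.setUC finset.setDE finset.setUIr finset.setUCr
    finset.setIT; apply/esym/finset.setUidPr.
have cz0 : c z0 != i0.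
  apply: contraNneq (rooms_not_full cZ domZ) => cz0.
  by rewrite ZE imsetU1 cD0i cz0 finset.setUCr.
have : c z0 \in c @: D0 by rewrite cD0i finset.in_setC1.
case/imsetP => z1 z1D0 cz01.
have z01 : z0 != z1 by apply: contraNneq z0D0 => ->.
have ZD0 : Z :\ z0 = D0 by rewrite ZE finset.setU1K.
have -> : [set D | door D && (D \subset Z)] = [set Z :\ z0; Z :\ z1].
  apply/setP => D; rewrite inE in_set2; apply/andP/orP; last first.
    case=> /eqP->; first by rewrite ZD0 /door cD0 eqxx domD0 cD0i eqxx.
    split; last exact: finset.subsetDl.
    have Z1 : z1 \in Z by rewrite ZE finset.in_setU1 z1D0 orbT.
    rewrite /door (dominant_sub (finset.subsetDl _ _) domZ) -cZ (cardsD1 z1 Z)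
      Z1 eqxx /=.
    rewrite -cD0i ZE; apply/eqP/setP => i; apply/imsetP/imsetP => -[x].
      rewrite in_setD1 finset.in_setU1 => /andP[xz1 /predU1P[->|xD0]] ->.
        by exists z1.
      by exists x.
    move=> xD0 ->; have [->|xz1] := eqVneq x z1.
      by exists z0 => //; rewrite in_setD1 z01 finset.setU11.
    by exists x => //; rewrite in_setD1 xz1 finset.in_setU1 xD0 orbT.
  case=> /and3P[/eqP cD domD /eqP cDi] DZ.
  have : #|Z :\: D| == 1 by rewrite cardsDS // cZ -cD subSnn.
  move=> /cards1P[z ZDz].
  have DE : D = Z :\ z.
    by rewrite -ZDz finset.setDDr finset.setDv finset.set0U;
      apply/esym/finset.setIidPr.
  have zZ : z \in Z.
    have : z \in Z :\: D by rewrite ZDz finset.set11.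
    by rewrite finset.in_setD => /andP[].
  have [zz0|zz0] := eqVneq z z0; first by left; rewrite DE zz0.
  have [zz1|zz1] := eqVneq z z1; first by right; rewrite DE zz1.
  have zD0 : z \in D0 by move: zZ; rewrite ZE finset.in_setU1 (negbTE zz0).
  have : c z \in c @: D by rewrite cDi -cD0i imset_f.
  case/imsetP => y; rewrite DE in_setD1 ZE finset.in_setU1.
  case/andP=> yz /predU1P[->|yD0].
    by rewrite cz01 => /injD0 zz; rewrite zz ?eqxx in zz1.
  by move=> /injD0 zy; rewrite zy ?eqxx in yz.
rewrite cards2; suff -> : Z :\ z0 != Z :\ z1 by [].
apply: contraNneq z0D0 => Z01; rewrite -ZD0 Z01 in_setD1 z01 /=.
by rewrite ZE finset.setU11.
Qed.

Lemma card_rooms_of_door D : door D ->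
  #|[set Z | room Z && (D \subset Z)]| =
  #|[set x | (x \notin D) && dominant rk (x |: D)]|.
Proof.
move=> /and3P[/eqP cD _ _].
rewrite -(@card_in_imset _ _ (fun x => x |: D)); last first.
  move=> x y; rewrite !inE => /andP[xD _] /andP[yD _] xy.
  have := finset.setU11 x D; rewrite xy finset.in_setU1 => /predU1P[//|xD'].
  by rewrite xD' in xD.
apply: eq_card => Z; rewrite inE; apply/andP/imsetP => [[/andP[/eqP cZ domZ]
  DZ]|].
  have : #|Z :\: D| == 1 by rewrite cardsDS // cZ -cD subSnn.
  move=> /cards1P[z ZDz].
  have ZE : Z = z |: D.
    by rewrite -ZDz finset.setUC finset.setDE finset.setUIr finset.setUCr
      finset.setIT; apply/esym/finset.setUidPr.
  exists z => //; rewrite inE -ZE domZ andbT.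
  have : z \in Z :\: D by rewrite ZDz finset.set11.
  by rewrite finset.in_setD => /andP[].
move=> [x]; rewrite inE => /andP[xD domx] ->; rewrite finset.subsetUr.
by rewrite /room domx cardsU1 xD add1n cD eqxx.
Qed.

Lemma double_count :
  \sum_(Z | room Z) #|[set D | door D && (D \subset Z)]| =
  \sum_(D | door D) #|[set Z | room Z && (D \subset Z)]|.
Proof.
under eq_bigr do rewrite -sum1dep_card.
rewrite (exchange_big_dep door) => [|Z D _ /andP[]//].
by apply: eq_bigr => D ->; rewrite -sum1dep_card.
Qed.
End ScarfParity.

Section Scarf.
Variables (I T : finType) (rk : I -> T -> nat) (c : T -> I) (t0 : T).
Hypothesis rk_inj : forall i, injective (rk i).
Hypothesis cardI : 1 < #|I|.

(* In the order [i], the slack element [inr i] is below all of [T] and the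
   other slack elements are above all of [T]. *)
Definition slack_rk i (v : T + I) : nat :=
  match v with
  | inl t => (rk i t).+1
  | inr k => if k == i then 0 else (\max_(t : T) rk i t).+2 + enum_rank k
  end.

Definition slack_color (v : T + I) := match v with inl t => c t | inr i =>
  i end.

Lemma slack_rk_inj i : injective (slack_rk i).
Proof.
move=> [t|k] [t'|k'] //=.
- by move=> [/rk_inj->].
- case: eqP => // _ [] tk; have := @leq_bigmax T (rk i) t.
  by rewrite tk addSn ltnNge leq_addr.
- case: eqP => // _ [] tk; have := @leq_bigmax T (rk i) t'.
  by rewrite -tk addSn ltnNge leq_addr.
case: eqP => [->|ki]; case: eqP => [->|k'i] //.
by move=> /addnI/val_inj/enum_rank_inj->.
Qed.

(** Take a room with all colours; [S] is its part in [T] and [J] the set of indices whose slack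
    element is missing, so that these colours must come from [S]. A slack element [inr i] in the
    room is below all of [T] in order [i], so points of [T] can only be dominated in orders of
    [J]. *)
Theorem scarf : exists (S : {set T}) (J : {set I}), J \subset c @: S /\
  forall y, exists2 i, i \in J & forall x, x \in S -> rk i y <= rk i x.
Proof.
suff [Z [cZ domZ ZI]] : exists Z : {set T + I},
    [/\ #|Z| = #|I|, dominant slack_rk Z & slack_color @: Z = [set: I]].
  exists [set t | inl t \in Z], [set i | inr i \notin Z]; split.
    apply/fintype.subsetP => i; rewrite inE => iZ.
    have : i \in slack_color @: Z by rewrite ZI.
    case/imsetP => -[t|k] vZ /= ik; last by rewrite ik vZ in iZ.
    by apply/imsetP; exists t => //; rewrite inE.
  move=> y; have /dominantP/(_ (inl y))[i Hi] := domZ; exists i.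
    by rewrite inE; apply/negP => /Hi /=; rewrite eqxx.
  by move=> x; rewrite inE => /Hi.
apply: contrapT => nfull.
have [i0 _] : exists i0 : I, i0 \in I by apply/card_gt0P;
  apply: ltn_trans cardI.
(* The outer door, made of slack elements only. *)
pose D0 : {set T + I} := inr @: [set~ i0].
have full (Z : {set T + I}) : #|Z| = #|I| -> dominant slack_rk Z ->
  slack_color @: Z != [set: I].
  by move=> cZ domZ; apply/eqP => ZI; apply: nfull; exists Z.
pose rm := room slack_rk; pose dr := door slack_rk slack_color i0.
have D0E (D : {set T + I}) : dr D -> (forall t, inl t \notin D) -> D = D0.
  move=> /and3P[_ _ /eqP cD] Dr; apply/setP => -[t|k].
    rewrite (negbTE (Dr t)); apply/esym/negbTE/imsetP => -[] //.
  rewrite mem_imset; last by move=> ? ? [].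
  rewrite -cD; apply/idP/imsetP => [kD|[[t|k'] vD -> //]];
    first by exists (inr k).
  by have := Dr t; rewrite vD.
(* Such a door contains some [inl t], so its minimum in order [i] is a point of [T] or [inr i].
   Hence [inr j] exceeds the minima in all orders but [j], and both candidate sets for a new element
   are nonempty. *)
have evenD (D : {set T + I}) : dr D -> D != D0 -> ~~ odd #|[set Z |
  rm Z && (D \subset Z)]|.
  move=> drD DD0; have /and3P[/eqP cD domD /eqP cDi] := drD.
  have [t tD] : exists t, inl t \in D.
    apply: contrapT => nt; case/eqP: DD0; apply: D0E => // t.
    by apply/negP => tD; apply: nt; exists t.
  have [|m mD] := @lowest_fun _ _ slack_rk D.
    by apply/finset.set0Pn; exists (inl t).
  have abv j : m @: [set~ j] = D -> above slack_rk m j != finset.set0.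
    move=> mj; apply/finset.set0Pn; exists (inr j); apply/aboveP => i ij.
    have /lowestP[miD /(_ _ tD)] := mD i.
    rewrite /= eq_sym (negbTE ij); case: (m i) => [t' /=|k /=].
      by move=> _; apply: leq_trans (leq_addr _ _); rewrite !ltnS leq_bigmax.
    have [//|ki] := eqVneq k i; rewrite addSn ltnS => /leq_trans-/(_ _
      (@leq_bigmax T (rk i) t)).
    by rewrite addSn ltnNge leq_addr.
  rewrite (card_rooms_of_door drD).
  have [j1 [j2 [/abv-> /abv-> _ ->]]] //:= card_rooms slack_rk_inj mD domD cD.
have dom0 : dominant slack_rk D0.
  apply/dominantP => -[t|k].
    exists i0 => z /imsetP[i]; rewrite finset.in_setC1 => ii0 -> /=.
    rewrite (negbTE ii0) addSn !ltnS; apply: leq_trans (leq_addr _ _).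
    exact: leqW (@leq_bigmax T (rk i0) t).
  by exists k => z _ /=; rewrite eqxx.
have drD0 : dr D0.
  apply/and3P; split=> //.
    rewrite card_imset ?cardsC1; last by move=> ? ? [].
    by rewrite prednK // (ltn_trans _ cardI).
  apply/eqP; rewrite /D0 -imset_comp; apply/setP => i.
  by apply/imsetP/idP => [[k ki -> //]|ii]; exists i.
(* For [i != i0] the slack element [inr i] of [D0] rules out the order [i] for dominating points of
   [T]. Only [i0] is left, so the added element must be the highest point of [T] in that order. *)
have card0 : #|[set Z | rm Z && (D0 \subset Z)]| = 1.
  rewrite (card_rooms_of_door drD0); apply/eqP/cards1P.
  have [t _ tmax] := @arg_maxnP _ t0 xpredT (rk i0) isT.
  exists (inl t); apply/setP => v; rewrite inE finset.in_set1.
  apply/andP/eqP => [|->]; last first.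
    split; first by apply/imsetP => -[].
    apply/dominantP => -[t'|k]; last by exists k => z _ /=; rewrite eqxx.
    exists i0 => z; rewrite finset.in_setU1 => /predU1P[->|].
      by rewrite /= ltnS; apply: tmax.
    move=> /imsetP[i]; rewrite finset.in_setC1 => ii0 -> /=.
    rewrite (negbTE ii0) addSn !ltnS; apply: leq_trans (leq_addr _ _).
    exact: leqW (@leq_bigmax T (rk i0) t').
  case: v => [t'|k] [kD /dominantP/(_ (inl t))[i Hi]].
    have ii0 : i = i0.
      have [//|ii0] := eqVneq i i0.
      have iD : inr i \in inl t' |: D0.
        by rewrite finset.in_setU1 imset_f ?orbT ?finset.in_setC1.
      by have := Hi _ iD; rewrite /= eqxx.
    have := Hi (inl t'); rewrite finset.setU11 => /(_ isT) /=;
      rewrite ltnS ii0 => tt'.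
    congr inl; apply: (@rk_inj i0); apply/eqP; rewrite eqn_leq tt' andbT.
    exact: tmax.
  have iD : inr i \in inr k |: D0.
    rewrite finset.in_setU1; have [ii0|ii0] := eqVneq i i0; last first.
      by rewrite imset_f ?orbT ?finset.in_setC1.
    apply/orP; left; apply: contraNT kD => ik.
    by rewrite imset_f // finset.in_setC1; apply: contraNneq ik => ->;
      rewrite ii0.
  by have := Hi _ iD; rewrite /= eqxx.
have := double_count slack_rk slack_color i0.
rewrite (bigD1 D0 drD0) /= card0 => /(congr1 odd); rewrite oddD /=.
have ev (J : finType) (P : pred J) (F : J -> nat) : (forall j, P j ->
  ~~ odd (F j)) ->
    odd (\sum_(j | P j) F j) = false.
  move=> PF; elim/big_ind : _ => [//|x y|j /PF/negbTE//].
  by rewrite oddD => -> ->.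
rewrite !ev // => [D /andP[]|Z]; first exact: evenD.
exact: even_doors.
Qed.
End Scarf.

(** * Colourings of the grid in a simplex *)

Section Grid.
Variables (I : finType) (k : nat).

(* The points of the simplex with barycentric coordinates in [1/k Z], scaled
   by [k]. *)
Definition grid := {x : {ffun I -> 'I_k.+1} | (\sum_i (x i : nat) == k)%N}.

Definition gcoord (x : grid) i : nat := val x i.

Lemma sum_gcoord x : (\sum_i gcoord x i)%N = k.
Proof. exact/eqP/(valP x). Qed.

Lemma gridP (h : I -> nat) : (\sum_i h i)%N = k ->
  exists x, forall i, gcoord x i = h i.
Proof.
move=> hk; have hlt i : (h i < k.+1)%N by rewrite ltnS -hk (bigD1 i) //=
  leq_addr.
have xP : (\sum_i ([ffun i => Ordinal (hlt i)] i : nat) == k)%N.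
  by under eq_bigr do rewrite ffunE /=; rewrite hk.
by exists (Sub [ffun i => Ordinal (hlt i)] xP : grid) => i;
  rewrite /gcoord /= ffunE.
Qed.

(** Orders by the [i]-th coordinate; ties are broken by a fixed enumeration of the grid, to make the
    rank injective. *)
Definition grid_rk i (x : grid) : nat := (gcoord x i * #|{: grid}|
  + enum_rank x)%N.

Lemma grid_rk_inj i : injective (grid_rk i).
Proof.
move=> x y /(congr1 (modn^~ #|{: grid}|)).
by rewrite !modnMDl !modn_small // => /val_inj/enum_rank_inj.
Qed.

Lemma grid_rk_le i x y : (grid_rk i x <= grid_rk i y)%N -> (gcoord x i <=
  gcoord y i)%N.
Proof.
apply: contraTT; rewrite -!ltnNge => yx.
apply: (@leq_trans ((gcoord y i).+1 * #|{: grid}|)).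
  by rewrite /grid_rk mulSnr ltn_add2l.
by rewrite -[X in (X <= _)%N]addn0 leq_add // leq_mul2r yx orbT.
Qed.

(** Let [m i] be the least [i]-th coordinate on the set [S] of Scarf's lemma. Dominance forbids a
    grid point with coordinates at least [m i + 1] for all [i] in [J], so these numbers have a sum
    larger than [k], the sum of all coordinates of a grid point. Hence on [S] the coordinates in [J]
    exceed [m] by at most [#|I|], and the others are at most [#|I|]. *)
Lemma sperner_grid (c : grid -> I) : (1 < #|I|)%N ->
  exists x, forall i, (gcoord x i <= #|I|)%N \/ exists2 s, c s = i &
    forall l, (gcoord s l <= gcoord x l + #|I| /\ gcoord x l <= gcoord s l +
      #|I|)%N.
Proof.
move=> I1.
have [i0 _] : exists i0 : I, i0 \in I by apply/card_gt0P; apply: ltn_trans I1.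
have [t0 _] : exists t0 : grid, true.
  have [|x _] := @gridP (fun i => if i == i0 then k else 0); last by exists x.
  by rewrite -big_mkcond big_pred1_eq.
have [S [J [JS dom]]] := scarf c t0 grid_rk_inj I1.
have [x xS] : exists x, x \in S.
  have [i iJ _] := dom t0.
  by have /imsetP[x xS _] := fintype.subsetP JS i iJ; exists x.
pose m i := gcoord [arg min_(y < x in S) gcoord y i] i.
have mS i y : y \in S -> (m i <= gcoord y i)%N.
  by move=> yS; rewrite /m; case: arg_minnP => // z _; apply.
have mE i : exists2 y, y \in S & gcoord y i = m i.
  by rewrite /m; case: arg_minnP => // z zS _; exists z.
have sumJ : (k < \sum_(i in J) (m i).+1)%N.
  rewrite ltnNge; apply/negP => sk.
  have [j jJ _] := dom t0.
  (* The forbidden grid point: all minima in [J] are raised by one, and what remains of [k] is given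
     to one index [j] of [J]. *)
  pose h i := ((if i \in J then (m i).+1 else 0) +
               (if i == j then k - \sum_(i in J) (m i).+1 else 0))%N.
  have [|y yh] := @gridP h.
    by rewrite big_split /= -!big_mkcond /= big_pred1_eq subnKC.
  have [i iJ Hi] := dom y; have [z zS zm] := mE i.
  by have := grid_rk_le (Hi z zS); rewrite yh zm /h iJ addSn ltnNge leq_addr.
have sumJm : (k < \sum_(i in J) m i + #|J|)%N.
  by move: sumJ; under eq_bigr do rewrite -addn1;
    rewrite big_split /= sum1_card.
have JI : (#|J| <= #|I|)%N by apply: max_card.
have inJ y i : y \in S -> i \in J -> (gcoord y i <= m i + #|I|)%N.
  move=> yS iJ; move: sumJm; rewrite -(sum_gcoord y) (bigID (mem J)) /=.
  rewrite (bigD1 i) //= [X in (_ < X + _)%N](bigD1 i) //=.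
  have : (\sum_(l in J | l != i) m l <= \sum_(l in J | l != i) gcoord y l)%N.
    by apply: leq_sum => l _; apply: mS.
  move: JI; set A1 := \sum_(l in J | l != i) m l; set A2 := \sum_(l in J |
    l != i) gcoord y l.
  set A3 := bigop.body _ _ _; set A4 := #|J|. set A5 := #|I|. set A6 := gcoord
    _ _. set A7 := m _. lia.
have notJ y i : y \in S -> i \notin J -> (gcoord y i <= #|I|)%N.
  move=> yS iJ; move: sumJm; rewrite -(sum_gcoord y) (bigID (mem J)) /=.
  rewrite [X in (_ + X < _)%N](bigD1 i) //=.
  have : (\sum_(l in J) m l <= \sum_(l in J) gcoord y l)%N.
    by apply: leq_sum => l _; apply: mS.
  move: JI; set A1 := \sum_(l in J) m l; set A2 := \sum_(l in J) gcoord y l.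
  set A3 := bigop.body _ _ _; set A4 := #|J|; set A5 := #|I|;
    set A6 := gcoord _ _.
  lia.
exists x => i; have [iJ|/notJ iJ] := boolP (i \in J); last by left; apply: iJ.
right; have /imsetP[s sS ->] := fintype.subsetP JS i iJ.
exists s => // l; have [lJ|lJ] := boolP (l \in J).
  split; [apply: leq_trans (inJ _ _ sS lJ) _|apply: leq_trans (inJ _ _ xS lJ)
    _];
    by rewrite leq_add2r mS.
split; [apply: leq_trans (notJ _ _ sS lJ) _|apply: leq_trans (notJ _ _ xS lJ)
  _];
  exact: leq_addl.
Qed.
End Grid.

Local Open Scope classical_set_scope.
Local Open Scope ring_scope.

(** * Continuity of maps given by formulas *)

Section ContinuityOfLambdas.
Variables (R : realType) (T : topologicalType) (x : T).

Lemma cont_cst (S : topologicalType) (s : S) : continuous_at x (fun _ : T => s).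
Proof. exact: cvg_cst. Qed.

Lemma eq_cont (S : topologicalType) (f g : T -> S) :
  f =1 g -> continuous_at x f -> continuous_at x g.
Proof. by move=> /funext->. Qed.

Lemma cont_id : continuous_at x (fun y : T => y).
Proof. exact: cvg_id. Qed.

Lemma cont_comp (S S' : topologicalType) (f : T -> S) (g : S -> S') :
  continuous_at x f -> continuous_at (f x) g ->
  continuous_at x (fun y => g (f y)).
Proof. exact: continuous_comp. Qed.

Lemma cont_pair (S S' : topologicalType) (f : T -> S) (g : T -> S') :
  continuous_at x f -> continuous_at x g ->
  continuous_at x (fun y => (f y, g y)).
Proof. by move=> cf cg; apply: cvg_pair. Qed.

Lemma cont_fst (S S' : topologicalType) (f : T -> S * S') :
  continuous_at x f -> continuous_at x (fun y => (f y).1).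
Proof. by move=> cf; apply: (cont_comp cf); apply: cvg_fst. Qed.

Lemma cont_snd (S S' : topologicalType) (f : T -> S * S') :
  continuous_at x f -> continuous_at x (fun y => (f y).2).
Proof. by move=> cf; apply: (cont_comp cf); apply: cvg_snd. Qed.

Lemma contD (V : normedModType R) (f g : T -> V) :
  continuous_at x f -> continuous_at x g ->
  continuous_at x (fun y => f y + g y).
Proof. exact: cvgD. Qed.

Lemma contB (V : normedModType R) (f g : T -> V) :
  continuous_at x f -> continuous_at x g ->
  continuous_at x (fun y => f y - g y).
Proof. exact: cvgB. Qed.

Lemma contM (f g : T -> R) :
  continuous_at x f -> continuous_at x g ->
  continuous_at x (fun y => f y * g y).
Proof. exact: cvgM. Qed.

Lemma contZ (V : normedModType R) (f : T -> R) (g : T -> V) :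
  continuous_at x f -> continuous_at x g ->
  continuous_at x (fun y => f y *: g y).
Proof. exact: cvgZ. Qed.

Lemma cont_min (f g : T -> R) :
  continuous_at x f -> continuous_at x g ->
  continuous_at x (fun y => Num.min (f y) (g y)).
Proof. by move=> cf cg; have := continuous_min cf cg. Qed.

Lemma cont_max (f g : T -> R) :
  continuous_at x f -> continuous_at x g ->
  continuous_at x (fun y => Num.max (f y) (g y)).
Proof. by move=> cf cg; have := continuous_max cf cg. Qed.

Lemma cont_norm (V : normedModType R) (f : T -> V) :
  continuous_at x f -> continuous_at x (fun y => `|f y|).
Proof. by move=> cf; apply: cont_comp cf _; apply: norm_continuous. Qed.

Lemma cont_coord n (f : T -> 'rV[R]_n) i :
  continuous_at x f -> continuous_at x (fun y => f y ord0 i).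
Proof.
by move=> cf; apply: (cont_comp (g := fun v : 'rV[R]_n => v ord0 i) cf);
  apply: coord_continuous.
Qed.

Lemma cont_sum n (f : 'I_n -> T -> R) :
  (forall i, continuous_at x (f i)) ->
  continuous_at x (fun y => \sum_i f i y).
Proof.
move=> cf; elim: n f cf => [|n IH] f cf.
  by apply: (@eq_cont _ (fun=> 0)) => [y|]; [rewrite big_ord0|exact: cont_cst].
apply: eq_cont (contD (IH (fun i => f (widen_ord _ i)) (fun i =>
  cf _)) (cf ord_max)).
by move=> y; rewrite big_ord_recr.
Qed.

Lemma cont_rV n (f : T -> 'rV[R]_n) :
  (forall i, continuous_at x (fun y => f y ord0 i)) -> continuous_at x f.
Proof.
move=> cf A [P Pnbhs PA]; rewrite /= nbhs_simpl.
have : \forall y \near x, forall i, P ord0 i (f y ord0 i).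
  by apply: filter_forall => i; apply: cf; apply: Pnbhs.
by apply: filterS => y Py; apply: PA => i j; rewrite ord1.
Qed.

Lemma cont_row_mx n m (f : T -> 'rV[R]_n) (g : T -> 'rV[R]_m) :
  continuous_at x f -> continuous_at x g ->
  continuous_at x (fun y => row_mx (f y) (g y)).
Proof.
move=> cf cg; apply: cont_rV => i; case: (split_ordP i) => j ->.
  by apply: (@eq_cont _ (fun y => f y ord0 j)) => [y|];
    [rewrite row_mxEl|exact: cont_coord].
by apply: (@eq_cont _ (fun y => g y ord0 j)) => [y|];
  [rewrite row_mxEr|exact: cont_coord].
Qed.

Lemma cont_lsubmx n m (f : T -> 'rV[R]_(n + m)) :
  continuous_at x f -> continuous_at x (fun y => lsubmx (f y)).
Proof.
move=> cf; apply: cont_rV => i.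
by apply: (@eq_cont _ (fun y => f y ord0 (lshift m i))) => [y|];
  [rewrite mxE|exact: cont_coord].
Qed.

Lemma cont_rsubmx n m (f : T -> 'rV[R]_(n + m)) :
  continuous_at x f -> continuous_at x (fun y => rsubmx (f y)).
Proof.
move=> cf; apply: cont_rV => i.
by apply: (@eq_cont _ (fun y => f y ord0 (rshift n i))) => [y|];
  [rewrite mxE|exact: cont_coord].
Qed.

Lemma near_eq_cont (S : topologicalType) (f g : T -> S) :
  (\forall y \near x, f y = g y) -> continuous_at x f -> continuous_at x g.
Proof.
move=> fg cf; have fgx := nbhs_singleton fg.
rewrite /continuous_at -fgx; apply: cvg_trans cf; apply: near_eq_cvg.
exact: fg.
Qed.

End ContinuityOfLambdas.

Ltac cont1 :=
  match goal with
  | |- continuous_at _ (fun _ => ?c) => exact: cont_cst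
  | |- continuous_at _ (fun y => y) => exact: cont_id
  | H : continuous_at ?x ?f |- continuous_at ?x ?f => exact: H
  | |- continuous_at _ (fun y => (@?f y, @?g y)) => apply: (@cont_pair _ _ _ _
    f g)
  | |- continuous_at _ (fun y => @?f y - @?g y) => apply: (@contB _ _ _ _ f g)
  | |- continuous_at _ (fun y => @?f y + @?g y) => apply: (@contD _ _ _ _ f g)
  | |- continuous_at _ (fun y => @?f y * @?g y) => apply: (@contM _ _ _ f g)
  | |- continuous_at _ (fun y => @?f y *: @?g y) => apply: (@contZ _ _ _ _ f g)
  | |- continuous_at _ (fun y => Num.min (@?f y) (@?g y)) => apply: (@cont_min
    _ _ _ f g)
  | |- continuous_at _ (fun y => Num.max (@?f y) (@?g y)) => apply: (@cont_max
    _ _ _ f g)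
  | |- continuous_at _ (fun y => `|@?f y|) => apply: (@cont_norm _ _ _ _ f)
  | |- continuous_at _ (fun y => row_mx (@?f y) (@?g y)) =>
    apply: (@cont_row_mx _ _ _ _ _ f g)
  | |- continuous_at _ (fun y => lsubmx (@?f y)) => apply: (@cont_lsubmx _ _ _
    _ _ f)
  | |- continuous_at _ (fun y => rsubmx (@?f y)) => apply: (@cont_rsubmx _ _ _
    _ _ f)
  | |- continuous_at _ (fun y => fun_of_matrix (@?f y) _ _) =>
    apply: (@cont_coord _ _ _ _ f)
  | |- continuous_at _ (fun y => (@?f y).1) => apply: (@cont_fst _ _ _ _ f)
  | |- continuous_at _ (fun y => (@?f y).2) => apply: (@cont_snd _ _ _ _ f)
  end.
Ltac cont := rewrite /prop_for; repeat cont1.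

(** * Brouwer's fixed point theorem *)

Section RowNorm.
Variables (R : realType) (n : nat).
Implicit Type v : 'rV[R]_n.

Lemma coord_norm_le v i : `|v ord0 i| <= `|v|.
Proof.
by rewrite [leRHS]/Num.norm/= mx_normrE; apply: (le_bigmax _ (fun ij =>
  `|v ij.1 ij.2|) (ord0, i)).
Qed.

Lemma norm_rV_le e v : 0 <= e -> (forall i, `|v ord0 i| <= e) -> `|v| <= e.
Proof.
move=> e0 ve; rewrite [leLHS]/Num.norm/= mx_normrE; apply/bigmax_leP;
  split=> //.
by move=> [i j] _ /=; rewrite ord1.
Qed.
Lemma compact_norm_le (r : R) : compact [set v : 'rV[R]_n | `|v| <= r].
Proof.
apply: bounded_closed_compact.
  exists r; split=> [|M rM x /= xr]; first exact: num_real.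
  exact: le_trans xr (ltW rM).
have := @closed_comp _ _ (fun x : 'rV[R]_n => `|x|) [set y | y <= r].
by apply=> [x _|]; [exact: norm_continuous|exact: closed_le].
Qed.

End RowNorm.

(** The simplex with barycentric coordinates [b] contains the cube of radius [B], hence all values
    of [f]. Colour a point by a coordinate that [f] does not decrease. Ever finer grids accumulate
    at a point where no coordinate decreases; as the coordinates have sum 1, all of them are
    preserved. *)
Theorem brouwer (R : realType) (n : nat) (f : 'rV[R]_n -> 'rV[R]_n) (B : R) :
  continuous f -> (forall x, `|f x| <= B) -> exists x, f x = x.
Proof.
move=> cf; wlog B0 : B / 0 < B => [wl fB|fB].
  apply: (wl (`|B| + 1)); first by rewrite ltr_wpDl.
  by move=> x; apply: le_trans (fB x) _; rewrite (le_trans (ler_norm B)) //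
    lerDl.
case: n f cf fB => [|n] f cf fB; first by exists 0; apply/rowP => -[].
(* With this scale each [a j] is at most [1 / n.+1] on the cube, which keeps [b ord0] nonnegative
   there. *)
pose C := B * 2 * n.+1%:R.
have C0 : 0 < C by rewrite !mulr_gt0.
pose a (j : 'I_n.+1) (x : 'rV[R]_n.+1) := (x ord0 j + B) / C.
pose b (i : 'I_n.+2) x := if unlift ord0 i is Some j then a j x else 1 - \sum_j
  a j x.
have b0 x : b ord0 x = 1 - \sum_j a j x by rewrite /b unlift_none.
have bS j x : b (lift ord0 j) x = a j x by rewrite /b liftK.
have sumb x : \sum_i b i x = 1.
  by rewrite big_ord_recl b0 (eq_bigr _ (fun j _ => bS j x)) subrK.
have ca j : continuous (a j).
  by move=> x; rewrite /a; cont.  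
have cb i : continuous (b i).
  move=> x; rewrite /b; case: (unlift ord0 i) => [j|]; first exact: ca.
  by apply: contB; [cont|apply: cont_sum => j; exact: ca].
have bf i x : 0 <= b i (f x).
  have fj j : - B <= f x ord0 j <= B by rewrite -ler_norml (le_trans
    (coord_norm_le _ _)).
  rewrite /b; case: (unlift ord0 i) => [j|].
    by have /andP[fj1 _] := fj j; apply: divr_ge0 (ltW C0); lra.
  rewrite subr_ge0; apply: (@le_trans _ _ (\sum_(j < n.+1) n.+1%:R^-1)).
    apply: ler_sum => j _; rewrite ler_pdivrMr // /C mulrCA mulVf ?mulr1 //.
    by have := fj j; lra.
  by rewrite sumr_const card_ord -[leLHS]mulr_natl mulfV.
have sel x : exists i, b i x <= b i (f x).
  apply: contrapT => /forallNP nle.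
  have : \sum_i b i (f x) < \sum_i b i x.
    apply: ltr_sum; first by apply/hasP; exists ord0; rewrite ?mem_index_enum.
    by move=> i _; rewrite ltNge; apply/negP/nle.
  by rewrite !sumb ltxx.
have {sel} [c cP] := choice sel.
pose pt k (x : grid 'I_n.+2 k.+1) : 'rV[R]_n.+1 :=
  \row_j (C * ((gcoord x (lift ord0 j))%:R / k.+1%:R) - B).
have bpt k (x : grid 'I_n.+2 k.+1) i : b i (pt k x) = (gcoord x i)%:R / k.+1%:R.
  have apt j : a j (pt k x) = (gcoord x (lift ord0 j))%:R / k.+1%:R.
    by rewrite /a mxE subrK mulrAC mulfV ?mul1r // gt_eqF.
  case: (unliftP ord0 i) => [j ->|->]; first by rewrite bS apt.
  rewrite b0; under eq_bigr do rewrite apt.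
  rewrite -mulr_suml; have := sum_gcoord x; rewrite big_ord_recl =>
    /(congr1 (fun m => m%:R : R)).
  by rewrite natrD natr_sum => /eqP; rewrite eq_sym -subr_eq => /eqP <-;
    rewrite mulrBl mulfV // subKr.
have comb k : exists u : 'rV[R]_n.+1, `|u| <= C + B /\ forall i,
    b i u <= n.+2%:R / k.+1%:R \/
    exists2 s, `|s - u| <= C * n.+2%:R / k.+1%:R & b i s <= b i (f s).
  have [|x xP] := @sperner_grid 'I_n.+2 k.+1 (fun x => c (pt k x)).
    by rewrite card_ord.
  exists (pt k x); split.
    apply: norm_rV_le => [|j]; first by rewrite addr_ge0 ?ltW.
    rewrite mxE (le_trans (ler_normB _ _)) // [`|B|]gtr0_norm // lerD2r.
    rewrite normrM gtr0_norm // ler_piMr ?(ltW C0) // ger0_norm ?divr_ge0 //.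
    rewrite ler_pdivrMr // mul1r ler_nat -[leqRHS](sum_gcoord x).
    by rewrite (bigD1 (lift ord0 j)) //= leq_addr.
  move=> i; have [xi|[s si sx]] := xP i.
    by left; rewrite bpt ler_pM2r ?invr_gt0 // ler_nat (leq_trans xi) //
      card_ord.
  right; exists (pt k s); last by rewrite -si; apply: cP.
  apply: norm_rV_le => [|j]; first by rewrite !mulr_ge0 ?ltW.
  rewrite !mxE opprB addrA subrK -mulrBr -mulrBl normrM gtr0_norm // -mulrA.
  rewrite ler_pM2l // normrM [`|_^-1|]gtr0_norm ?invr_gt0 // ler_pM2r ?invr_gt0
    //.
  have [] := sx (lift ord0 j); rewrite -!(ler_nat R) !natrD card_ord => s1 s2.
  by rewrite ler_norml; lra.
have {comb} [u uP] := choice comb.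
have [|p [_ clp]] := @compact_norm_le R n.+1 (C + B) (u @ \oo) _ _.
  by exists 0%N => // k _ /=; have [] := uP k.
exists p.
(* Along the cluster sequence, either coordinate [i] is tiny, and then [b i (f p) >= 0] suffices, or
   points [s] of colour [i] come close to [p], and the inequality at [s] passes to the limit. *)
have bpf i : b i p <= b i (f p).
  apply/ler_addgt0Pl => e e0.
  pose h x := b i (f x) - b i x.
  have ch : continuous h.
    move=> x; apply: contB; last exact: cb.
    by apply: (@cont_comp _ _ _ _ f); [exact: cf|exact: cb].
  have : \forall x \near p, h x < h p + e /\ b i p < b i x + e / 2.
    near=> x; split; near: x.
      by apply: (cvgr_lt (h p)); [exact: ch|rewrite ltrDl].
    near=> x; rewrite -ltrBlDr; near: x.
    by apply: (cvgr_gt (b i p)); [exact: cb|rewrite ltrBlDr ltrDl divr_gt0].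
  move=> /nbhs_ballP[d /= d0 dP].
  have [k0 k0P] : exists k0, forall k, (k0 <= k)%N ->
      C * n.+2%:R / k.+1%:R < d / 2 /\ n.+2%:R / k.+1%:R < e / 2.
    have lim (x y : R) : 0 < y -> \forall k \near \oo, x / k.+1%:R < y.
      move=> y0; apply: (cvgr_lt (0 : R)) => //.
      by rewrite -[X in _ --> X](mulr0 x); apply: cvgMr; exact: cvg_harmonic.
    have [k0 _ k0P] : \forall k \near \oo,
        C * n.+2%:R / k.+1%:R < d / 2 /\ n.+2%:R / k.+1%:R < e / 2.
      by near=> k; split; near: k; apply: lim; rewrite divr_gt0.
    by exists k0 => k kk; apply: k0P.
  have [] := clp [set u k | k in [set k | (k0 <= k)%N]] (ball p (d / 2)).
    by exists k0 => // k /= kk; exists k.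
    by apply: nbhsx_ballx; rewrite divr_gt0.
  move=> _ [[k /= kk <-] pu].
  have [Cd ne] := k0P k kk.
  have dd : d = d / 2 + d / 2 by rewrite -splitr.
  have [_ /(_ i)[bu|[s su bs]]] := uP k.
    have [_ bpu] : h (u k) < h p + e /\ b i p < b i (u k) + e / 2.
      by apply: dP; apply: le_ball pu; rewrite ler_pdivrMr // ler_peMr ?ler1n
        // ltW.
    by have := le_lt_trans bu ne; have := bf i p; lra.
  have [hs _] : h s < h p + e /\ b i p < b i s + e / 2.
    apply: dP; rewrite dd; apply: ball_triangle pu _.
    rewrite -ball_normE /= distrC; exact: le_lt_trans Cd.
  by move: hs; rewrite /h; lra.
have bE i : b i (f p) = b i p.
  have : \sum_i (b i (f p) - b i p) == 0 by rewrite sumrB !sumb subrr.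
  rewrite psumr_eq0 => [/allP/(_ i (mem_index_enum _))/=|j _];
    last by rewrite subr_ge0.
  by rewrite subr_eq0 => /eqP.
apply/rowP => j; have := bE (lift ord0 j); rewrite !bS /a.
by move=> /(mulIf _)-/(_ (invr_neq0 (lt0r_neq0 C0)))/addIr.
Unshelve. all: by end_near.
Qed.

(** * Contractible closed manifolds *)

Section Pasting.
Variables (R : realType) (X S : topologicalType).

Lemma cont_paste (t : X -> R) (c : R) (f g : X -> S) :
  continuous t -> continuous f -> continuous g ->
  (forall x, t x = c -> f x = g x) ->
  continuous (fun x => if t x <= c then f x else g x).
Proof.
move=> ct cf cg fg x; case: (ltgtP (t x) c) => tx.
- apply: (near_eq_cont _ (cf x)); near=> y.
  by rewrite ltW //; near: y; apply: (cvgr_lt (t x)) => //; exact: ct.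
- apply: (near_eq_cont _ (cg x)); near=> y.
  by rewrite leNgt (_ : c < t y) //; near: y; apply: (cvgr_gt (t x)) => //;
    exact: ct.
move=> A; rewrite /= tx lexx => Af; rewrite nbhs_simpl /=.
have Ag : nbhs (g x) A by rewrite -fg.
by near=> y => /=; case: ifP => _; [near: y; exact: cf|near: y; exact: cg].
Unshelve. all: by end_near.
Qed.

Lemma contV (x : X) (f : X -> R) : f x != 0 -> continuous_at x f ->
  continuous_at x (fun y => (f y)^-1).
Proof. by move=> fx cf; apply: cvgV. Qed.

End Pasting.

(** At the infimum [m] of the failures, [P] holds below [m], hence at [m] by the first hypothesis,
    and then beyond [m] by the second, which is absurd. *)
Lemma real_induction (R : realType) (P : R -> Prop) (b : R) :
  (forall t, 0 <= t <= b -> (forall s, 0 <= s < t -> P s) -> P t) ->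
  (forall t, 0 <= t < b -> (forall s, 0 <= s <= t -> P s) ->
    exists2 e, 0 < e & forall s, t < s < t + e -> s <= b -> P s) ->
  forall t, 0 <= t <= b -> P t.
Proof.
move=> Pcl Pop t0 t0b; apply: contrapT => nPt0.
pose A := [set t | 0 <= t <= b /\ ~ P t].
have Alb : has_lbound A by exists 0 => t [/andP[]].
have Ainf : has_inf A by split=> //; exists t0.
pose m := inf A.
have mle t : A t -> m <= t by move=> At; apply: ge_inf.
have m0 : 0 <= m by apply: lb_le_inf; [exists t0|move=> t [/andP[]]].
have mb : m <= b by apply: le_trans (mle t0 _) _ => //; case/andP: t0b.
have Pm s : 0 <= s < m -> P s.
  move=> /andP[s0 sm]; apply: contrapT => nPs.
  by have := mle s; rewrite leNgt sm => /(_ _)/negP; apply; split=> //;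
    rewrite s0 ltW // (lt_le_trans sm).
have Pmm : P m by apply: Pcl => //; rewrite m0.
have Pm' s : 0 <= s <= m -> P s.
  by move=> /andP[s0]; rewrite le_eqVlt => /predU1P[->//|sm]; apply: Pm;
    rewrite s0.
have [mb'|mb'] := ltP m b; last first.
  apply: nPt0; apply: Pm'; case/andP: t0b => -> t0b.
  exact: le_trans mb'.
have [|e e0 Pe] := Pop m _ Pm'; first by rewrite m0.
have : m + e <= m.
  apply: lb_le_inf; first by exists t0.
  move=> t [/andP[t0' tb] nPt]; rewrite leNgt; apply/negP => te.
  have mt : m <= t by apply: mle; split=> //; rewrite t0'.
  apply: nPt; move: mt.
  by rewrite le_eqVlt => /predU1P[<-//|mt]; apply: Pe => //; rewrite mt.
by rewrite gerDl leNgt e0.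
Qed.

(* A chart around the closed ball of radius 2, with maps extended continuously
   to the whole space: [gauge] is the norm of the coordinate vector inside
   that ball, and is larger than 2 outside its image. *)
Record cell (R : realType) (T : topologicalType) (n : nat) := Cell {
  gauge : T -> R;
  cell_coord : T -> 'rV[R]_n;
  cell_point : 'rV[R]_n -> T;
  gauge_cont : continuous gauge;
  cell_coord_cont : continuous cell_coord;
  cell_point_cont : continuous cell_point;
  cell_coordK : forall y, gauge y <= 2 -> cell_point (cell_coord y) = y;
  cell_pointK : forall v, `|v| <= 2 -> cell_coord (cell_point v) = v;
  norm_cell_coord : forall y, gauge y <= 2 -> `|cell_coord y| = gauge y;
  gauge_point : forall v, `|v| <= 2 -> gauge (cell_point v) = `|v| }.

Section Cells.
Variables (R : realType) (T : topologicalType) (n : nat).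
Local Notation V := 'rV[R]_n.
Hypothesis T_hausdorff : hausdorff_space T.

Definition radial_clamp (r : R) (v : V) : V := (r / Num.max r `|v|) *: v.

Lemma radial_clamp_cont r : 0 < r -> continuous (radial_clamp r).
Proof.
move=> r0 v; rewrite /radial_clamp; cont; apply: contV; last by cont.
by rewrite gt_eqF // lt_max r0.
Qed.

Lemma norm_radial_clamp r v : 0 < r -> `|radial_clamp r v| <= r.
Proof.
move=> r0; have m0 : 0 < Num.max r `|v| by rewrite lt_max r0.
rewrite normrZ normrM normfV !gtr0_norm // -mulrA ler_piMr ?(ltW r0) //.
by rewrite mulrC ler_pdivrMr // mul1r le_max lexx orbT.
Qed.

Lemma radial_clamp_id r v : 0 < r -> `|v| <= r -> radial_clamp r v = v.
Proof.
by move=> r0 vr; rewrite /radial_clamp max_l // divff ?scale1r // gt_eqF.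
Qed.

Lemma cell_of_chart (c : chart R T n) (x0 : T) : is_chart c -> cdom c x0 ->
  exists e : cell R T n, gauge e x0 = 0.
Proof.
move=> cP x0c.
(* Coordinates are rescaled so that the closed ball of radius 3 fits in the chart; the shell between
   2 and 3 is used to cut off. *)
have [r r0 rP] : exists2 r : R, 0 < r & forall v : V, `|v| <= 3 ->
    (c @` cdom c) (c x0 + r *: v).
  have /nbhs_ballP[d /= d0 dP] : nbhs (c x0) (c @` cdom c).
    by apply: open_nbhs_nbhs; split; [exact: chart_open_img|exists x0].
  exists (d / 4); first by rewrite divr_gt0.
  move=> v v3; apply: dP; rewrite -ball_normE /= opprD addNKr normrN normrZ.
  rewrite gtr0_norm ?divr_gt0 // (@le_lt_trans _ _ (d / 4 * 3)) //.
    by rewrite ler_pM2l // divr_gt0.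
  lra.
pose c1 y : V := r^-1 *: (c y - c x0).
pose k1 (v : V) := cinv c (c x0 + r *: v).
have r_neq0 : r != 0 by rewrite gt_eqF.
have c1K y : cdom c y -> k1 (c1 y) = y.
  move=> yc; rewrite /k1 /c1 scalerA mulfV // scale1r addrC subrK.
  exact: chartK.
have k1P (v : V) : `|v| <= 3 -> cdom c (k1 v) /\ c1 (k1 v) = v.
  move=> /rP[y yc yE]; rewrite /k1 /c1 -yE (chartK cP) //; split=> //.
  by rewrite yE addrAC subrr add0r scalerA mulVf // scale1r.
have cc1 y : cdom c y -> continuous_at y c1.
  move=> yc; rewrite /c1; apply: contZ; first exact: cont_cst.
  by apply: contB; [exact: chart_continuous|exact: cont_cst].
have ck1 (v : V) : `|v| <= 3 -> continuous_at v k1.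
  move=> v3; rewrite /k1; apply: (@cont_comp _ _ _ _ (fun v : V =>
    c x0 + r *: v) (cinv c)).
    by cont.
  by apply: chart_inv_continuous; [|exact: rP].
(* [K] is compact, hence closed in all of [T]. So near a point outside the chart all scaled
   coordinates have norm above 3, and a function of the coordinates that is constant from norm 3 on
   extends continuously by that constant. *)
pose K := k1 @` [set v | `|v| <= 3].
have clK : closed K.
  apply: compact_closed => //; apply: continuous_compact;
    last exact: compact_norm_le.
  apply: continuous_in_subspaceT => v; rewrite inE /= => v3; exact: ck1.
have dom_near y : cdom c y -> \forall z \near y, cdom c z.
  by move=> yc; apply: open_nbhs_nbhs; split=> //; exact: chart_open_dom.
have out_near y : ~ cdom c y -> \forall z \near y, cdom c z -> 3 < `|c1 z|.
  move=> yc; have : \forall z \near y, ~ K z.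
    apply: open_nbhs_nbhs; split; first exact: closed_openC.
    by move=> [v v3 vy]; apply: yc; rewrite -vy; have [] := k1P _ v3.
  apply: filterS => z zK zc; rewrite ltNge; apply/negP => z3; apply: zK.
  by exists (c1 z) => //; exact: c1K.
have ext (S : topologicalType) (F : V -> S) (s0 : S) : continuous F ->
    (forall v : V, 3 <= `|v| -> F v = s0) ->
    continuous (fun y => if pselect (cdom c y) then F (c1 y) else s0).
  move=> cF F3 y; have [yc|yc] := pselect (cdom c y).
    apply: (@near_eq_cont _ _ _ (F \o c1)); last first.
      by apply: (@cont_comp _ _ _ _ c1); [exact: cc1|exact: cF].
    by apply: filterS (dom_near y yc) => z zc; case: pselect.
  apply: (@near_eq_cont _ _ _ (fun=> s0)); last exact: cont_cst.
  apply: filterS (out_near y yc) => z zc; case: pselect => // z'.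
  by rewrite F3 // ltW // zc.
pose F (v : V) : R := Num.min `|v| 3.
pose G (v : V) : V := Num.max 0 (Num.min 1 (3 - `|v|)) *: v.
have cF : continuous F by move=> v; rewrite /F; cont.
have cG : continuous G by move=> v; rewrite /G; cont.

pose g y := if pselect (cdom c y) then F (c1 y) else 3.
pose q y := if pselect (cdom c y) then G (c1 y) else 0.
have gE y : g y <= 2 -> cdom c y /\ g y = `|c1 y|.
  rewrite /g; case: pselect => // yc; last by lra.
  by rewrite /F ge_min => /orP[y2|]; [split; rewrite // min_l //|]; lra.
have GE (v : V) : `|v| <= 2 -> G v = v.
  by move=> v2; rewrite /G min_l ?max_r ?scale1r //; lra.
have kE (v : V) : `|v| <= 2 -> k1 (radial_clamp 2 v) = k1 v.
  by move=> v2; rewrite radial_clamp_id.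
have le23 (v : V) : `|v| <= 2 -> `|v| <= 3 :> R by lra.
have gk (v : V) : `|v| <= 2 -> g (k1 v) = `|v|.
  move=> v2; have [kc kv] := k1P v (le23 v v2).
  by rewrite /g; case: pselect => //= ?; rewrite kv /F min_l // le23.
have qE y : g y <= 2 -> q y = c1 y.
  by move=> g2; have [yc gy] := gE y g2; rewrite /q; case: pselect => //= ?;
    rewrite GE // -gy.
unshelve eexists; first apply: (@Cell _ _ _ g q (k1 \o radial_clamp 2)).
- apply: ext => // v v3; exact: min_r.
- apply: ext => // v v3; rewrite /G (_ : Num.max _ _ = 0) ?scale0r //.
  by apply: max_l; rewrite ge_min; apply/orP; right; lra.
- move=> v; apply: (@cont_comp _ _ _ _ (radial_clamp 2));
  first exact: radial_clamp_cont.
  by apply: ck1; apply: le23; exact: norm_radial_clamp.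
- move=> y g2; have [yc gy] := gE y g2.
  by rewrite /= (qE y g2) kE ?c1K // -gy.
- move=> v v2; rewrite /= kE // qE ?gk //.
  by have [] := k1P v (le23 v v2).
- by move=> y g2; rewrite qE //; have [_ ->] := gE y g2.
- by move=> v v2; rewrite /= kE // gk.
rewrite /= /g; case: pselect => //= ?.
by rewrite /F /c1 subrr scaler0 normr0 min_l.
Qed.

(** Compactness in its near-covering form, for the filter of properties shared by all lists that
    cover at least as much as some given list. *)
Lemma finite_cells (T_compact : compact [set: T])
    (T_cells : forall x : T, exists e : cell R T n, gauge e x = 0) :
  exists L : seq (cell R T n), forall x, has (fun e => gauge e x < 2^-1) L.
Proof.
pose covers (L : seq (cell R T n)) x := has (fun e => gauge e x < 2^-1) L.
pose F : set_system (seq (cell R T n)) :=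
  [set A | exists L0, forall L, covers L0 `<=` covers L -> A L].
have FF : Filter F.
  split; first by exists [::].
    move=> A B [L1 AL1] [L2 BL2]; exists (L1 ++ L2) => L L12.
    by split; [apply: AL1|apply: BL2] => x xL; apply: L12;
      rewrite /covers has_cat; apply/orP; [left|right].
  by move=> A B AB [L0 AL0]; exists L0 => L /AL0/AB.
have [x _|L LP] := (compact_near_coveringP _).1 T_compact _ F covers FF.
  have [e ex] := T_cells x.
  exists ([set y | gauge e y < 2^-1], [set L | covers [:: e] `<=` covers L]) =>
    /=.
    split; last by exists [:: e].
    by apply: (cvgr_lt (gauge e x)); [exact: gauge_cont|rewrite ex invr_gt0].
  by move=> [y L] [/= yx]; apply; rewrite /covers /= yx.
by exists L => x; apply: LP.
Qed.

End Cells.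

(** * A contractible closed manifold as a retract of a Euclidean space *)

Section FixedPoint.
Variables (R : realType) (T : topologicalType) (n : nat).
Local Notation V := 'rV[R]_n.
Variables (H : R * T -> T) (x0 : T).
Hypotheses (H_cont : continuous H) (H0 : forall x, H (0, x) = x)
  (H1 : forall x, H (1, x) = x0).

Section Join.
Variable e : cell R T n.
Local Notation coord := (cell_coord e).
Local Notation point := (cell_point e).
Local Notation clamp := (@radial_clamp R n 1).

(** Vanishes exactly if [a] is the point with coordinates [clamp w], and is 1 from gauge 2 on, where
    [coord] stops being faithful. *)
Definition join_time (a : T) (w : V) : R :=
  Num.min 1 (Num.max `|coord a - clamp w| (gauge e a - 1)).

(* A path, parametrized by [s] in [0, 3], from [a] to the point with
   coordinates [clamp w]: follow the contraction [H] for the time [join_time],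
   move along the image of a segment of the cell, and follow [H] backwards.
   The segment only makes sense for [a] inside the cell; outside, [join_time]
   is 1 and the segment is contracted to [x0].  The path is constant if its
   end points coincide. *)
Definition join (z : R * T * V) : T :=
  let: (s, a, w) := z in let t := join_time a w in
  if s <= 1 then H (s * t, a)
  else if s <= 2 then H (t, point ((2 - s) *: coord a + (s - 1) *: clamp w))
  else H ((3 - s) * t, point (clamp w)).

Lemma join_time_inside a w : gauge e a <= 2 \/ join_time a w = 1.
Proof.
have [|g2] := lerP (gauge e a) 2; [by left|right].
rewrite /join_time min_l // le_max; apply/orP; right; lra.
Qed.

Lemma join_time_diag w : `|w| <= 1 -> join_time (point w) w = 0.
Proof.
move=> w1; have w2 : `|w| <= 2 by lra.
rewrite /join_time radial_clamp_id // cell_pointK // subrr normr0.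
by rewrite gauge_point // max_l ?min_r //; lra.
Qed.

(** At the seam [s = 1], the point [point (coord a)] replaces [a]: they agree up to gauge 2, and
    beyond it the contraction has already sent both to [x0]. *)
Lemma join_cont : continuous join.
Proof.
have cclamp (z : R * T * V) : continuous_at z (fun z : R * T * V => clamp z.2).
  apply: (@cont_comp _ _ _ _ (fun z : R * T * V => z.2)); first by cont.
  exact: radial_clamp_cont.
have ccoord (z : R * T * V) : continuous_at z (fun z : R * T * V =>
  coord z.1.2).
  apply: (@cont_comp _ _ _ _ (fun z : R * T * V => z.1.2)); first by cont.
  exact: cell_coord_cont.
have cpoint (f : R * T * V -> V) z : continuous_at z f -> continuous_at z (fun
  z => point (f z)).
  by move=> cf; apply: (cont_comp cf); exact: cell_point_cont.
have cH (f : R * T * V -> R) (g : R * T * V -> T) z : continuous_at z f ->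
  continuous_at z g ->
    continuous_at z (fun z => H (f z, g z)).
  by move=> cf cg; apply: (@cont_comp _ _ _ _ (fun z => (f z, g z)));
    [cont|exact: H_cont].
have ctime (z : R * T * V) : continuous_at z (fun z : R * T * V =>
  join_time z.1.2 z.2).
  rewrite /join_time; cont; [exact: ccoord|exact: cclamp|].
  apply: (@cont_comp _ _ _ _ (fun z : R * T * V => z.1.2)); first by cont.
  exact: gauge_cont.
have -> : join = fun z : R * T * V => if z.1.1 <= 1 then H (z.1.1 * join_time
  z.1.2 z.2, z.1.2)
  else if z.1.1 <= 2 then H (join_time z.1.2 z.2,
      point ((2 - z.1.1) *: coord z.1.2 + (z.1.1 - 1) *: clamp z.2))
  else H ((3 - z.1.1) * join_time z.1.2 z.2, point (clamp z.2)).
  by apply/funext => -[[]].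
have e21 : 2 - 1 = 1 :> R by lra.
have e32 : 3 - 2 = 1 :> R by lra.
have e12 : 1 <= 2 :> R by lra.
apply: (@cont_paste _ _ _ (fun z : R * T * V => z.1.1)).
- by move=> z; cont.
- by move=> z; apply: cH; cont; exact: ctime.
- apply: (@cont_paste _ _ _ (fun z : R * T * V => z.1.1)).
  + by move=> z; cont.
  + move=> z; apply: cH; first exact: ctime.
    by apply: cpoint; cont; [exact: ccoord|exact: cclamp].
  + move=> z; apply: cH; first by cont; exact: ctime.
    by apply: cpoint; exact: cclamp.
  by move=> [[s a] w] /= ->; rewrite subrr scale0r add0r e21 e32 scale1r mul1r.
move=> [[s a] w] /= ->; rewrite e12 mul1r subrr scale0r addr0 e21 scale1r.
have [a2|->] := join_time_inside a w; first by rewrite cell_coordK.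
by rewrite !H1.
Qed.

Lemma join_end a w : `|w| <= 1 -> join (3, a, w) = point w.
Proof.
move=> w1; rewrite /join !ifN ?subrr ?mul0r ?H0 ?radial_clamp_id // -ltNge; lra.
Qed.

Lemma join_start a w : join (0, a, w) = a.
Proof. by rewrite /join ler01 mul0r H0. Qed.

Lemma join_diag s w : `|w| <= 1 -> join (s, point w, w) = point w.
Proof.
move=> w1; have w2 : `|w| <= 2 by lra.
rewrite /join join_time_diag // radial_clamp_id // cell_pointK // !mulr0 !H0.
by rewrite -scalerDl (_ : 2 - s + _ = 1) ?scale1r ?if_same //; lra.
Qed.
End Join.

(* Near [x] the coordinates of the embedding contain those of a cell around
   [x]; reading them in turn, the retraction moves to [x] by a join and then
   stays there. *)
Lemma retract_of_rV (L : seq (cell R T n)) :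
  exists (N : nat) (i : T -> 'rV[R]_N) (r : 'rV[R]_N -> T),
    [/\ continuous i, continuous r &
      forall x, has (fun e => gauge e x < 2^-1) L -> r (i x) = x].
Proof.
elim: L => [|e L [N [i [r [ci cr ri]]]]].
  by exists 0%N, (fun=> 0), (fun=> x0); split=> // x; exact: cont_cst.
(* Equal to 1 up to gauge 1/2, where the join must run to its end, and to 0 from gauge 1 on, where
   it must not start. In between the join is constant, its end points being equal. *)
pose bump (x : T) : 'rV[R]_1 :=
  const_mx (Num.max 0 (Num.min 1 (2 - 2 * gauge e x))).
have cgauge x : continuous_at x (fun y => gauge e y) by exact: gauge_cont.
exists (N + (1 + n))%N, (fun x => row_mx (i x) (row_mx (bump x) (cell_coord e
  x))),
  (fun y => join e (3 * lsubmx (rsubmx y) ord0 ord0, r (lsubmx y),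
    rsubmx (rsubmx y))).
split.
- move=> x; apply: cont_row_mx; first exact: ci.
  apply: cont_row_mx; last exact: cell_coord_cont.
  apply: cont_rV => j; apply: (@eq_cont _ _ _ (fun x => Num.max 0 (Num.min 1 (2
    - 2 * gauge e x)))).
    by move=> y; rewrite mxE.
  by cont.
- move=> y; apply: (@cont_comp _ _ _ _ (fun y : 'rV[R]_(N + (1 + n)) =>
    (3 * lsubmx (rsubmx y) ord0 ord0, r (lsubmx y), rsubmx (rsubmx y))));
      last exact: join_cont.
  cont; apply: (@cont_comp _ _ _ _ (fun y : 'rV[R]_(N + (1 + n)) => lsubmx y));
    first by cont.
  exact: cr.
move=> x; rewrite row_mxKl !row_mxKr row_mxKl mxE.
have gx2 : gauge e x < 1 -> gauge e x <= 2 by lra.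
have coord1 : gauge e x < 1 -> `|cell_coord e x| <= 1.
  by move=> gx; rewrite norm_cell_coord ?gx2 // ltW.
case/orP => [gx|xL].
  have gx1 : gauge e x < 1 by lra.
  have -> : Num.max 0 (Num.min 1 (2 - 2 * gauge e x)) = 1.
    by rewrite min_l ?max_r //; lra.
  by rewrite mulr1 join_end ?coord1 // cell_coordK ?gx2.
rewrite ri //; have [gx|gx] := ltP (gauge e x) 1.
  rewrite -[X in join _ (_, X, _)](@cell_coordK _ _ _ e) ?gx2 //.
  by rewrite join_diag ?coord1 // cell_coordK ?gx2.
have -> : Num.max 0 (Num.min 1 (2 - 2 * gauge e x)) = 0.
  by rewrite max_l // ge_min; apply/orP; right; lra.
by rewrite mulr0 join_start.
Qed.

Lemma contractible_fixed_point (L : seq (cell R T n)) :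
  compact [set: T] -> (forall x, has (fun e => gauge e x < 2^-1) L) ->
  forall q : T -> T, continuous q -> exists x, q x = x.
Proof.
move=> T_compact Lcov q cq; have [N [i [r [ci cr ri]]]] := retract_of_rV L.
have : bounded_set (i @` setT).
  by apply: compact_bounded; apply: continuous_compact => //;
    exact: continuous_subspaceT.
move=> [B [_ iB]].
have [|x|y yE] := @brouwer R N (fun y => i (q (r y))) (B + 1).
- move=> y; apply: (@cont_comp _ _ _ _ (fun y => q (r y))); last exact: ci.
  by apply: (@cont_comp _ _ _ _ r); [exact: cr|exact: cq].
- by apply: iB; [rewrite ltrDl|exists (q (r x))].
by exists (r y); rewrite -[in RHS]yE ri.
Qed.
End FixedPoint.

(** * Contractions, and coincidence-free approximation along a homotopy *)

Definition contractible (R : realType) (T : topologicalType) :=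
  exists (H : R * T -> T) (x0 : T),
    [/\ continuous H, forall x, H (0, x) = x & forall x, H (1, x) = x0].

(* [f] can be approximated by maps having no coincidence with [f].  In terms
   of the open neighbourhood [O] of the graph of [f], no metric is needed. *)
Definition avoidable (T : topologicalType) (f : T -> T) :=
  forall O : set (T * T), open O -> (forall x, O (x, f x)) ->
  exists2 q : T -> T, continuous q & forall x, q x <> f x /\ O (x, q x).

Lemma open_setP (T : topologicalType) (A : set T) :
  (forall x, A x -> nbhs x A) -> open A.
Proof. by move=> AP; rewrite openE. Qed.

Section Transport.
Variables (R : realType) (T : topologicalType) (n : nat).
Local Notation V := 'rV[R]_n.
Implicit Types (e : cell R T n) (f h : T -> T).

(** The case distinction makes the zero shift the identity of all of [T], also outside the cell,
    where [cell_point] does not invert [cell_coord]. *)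
Definition cell_shift e (w : V) (b : T) : T :=
  if w == 0 then b else cell_point e (cell_coord e b + w).

Lemma shift_inside e w b : gauge e b <= 2 ->
  cell_shift e w b = cell_point e (cell_coord e b + w).
Proof.
by move=> b2; rewrite /cell_shift; case: eqP => [->|//];
  rewrite addr0 cell_coordK.
Qed.

Section Shift.
Variables (e : cell R T n) (f : T -> T) (w : T -> V).
Hypotheses (f_cont : continuous f) (w_cont : continuous w).
Hypothesis w_small : forall x, w x != 0 -> gauge e (f x) <= 1 /\ `|w x| <= 2^-1.

(** A neighbourhood of the graph of [f] on which the shift is continuous: either [w] vanishes near
    the first component, or the second one is well inside the cell. *)
Let good : set (T * T) := [set z | 1 < gauge e (f z.1) \/ gauge e z.2 < 3 / 2].

Let good_near z : good z -> \forall y \near z, good y.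
Proof.
have cgf : continuous (fun z : T * T => gauge e (f z.1)).
  move=> y; apply: (@cont_comp _ _ _ _ (fun z : T * T => f z.1));
    last exact: gauge_cont.
  by apply: (@cont_comp _ _ _ _ (fun z : T * T => z.1)); [cont|exact: f_cont].
have cg : continuous (fun z : T * T => gauge e z.2).
  by move=> y; apply: (@cont_comp _ _ _ _ (fun z : T * T => z.2));
    [cont|exact: gauge_cont].
case=> gz; near=> y; [left|right]; near: y.
  by apply: (cvgr_gt (gauge e (f z.1))) => //; exact: cgf.
by apply: (cvgr_lt (gauge e z.2)) => //; exact: cg.
Unshelve. all: by end_near.
Qed.

Let good_graph x : good (x, f x).
Proof. by rewrite /good /=; have [|] := ltP 1 (gauge e (f x)); [left|right;
  lra]. Qed.

Let shift_cont z : good z -> continuous_at z (fun z : T * T => cell_shift e (w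
  z.1) z.2).
Proof.
move=> [gz|gz].
- apply: (@near_eq_cont _ _ _ (fun z : T * T => z.2)); last by cont.
  have cgf : continuous_at z (fun z : T * T => gauge e (f z.1)).
    apply: (@cont_comp _ _ _ _ (fun z : T * T => f z.1));
      last exact: gauge_cont.
    by apply: (@cont_comp _ _ _ _ (fun z : T * T => z.1)); [cont|exact: f_cont].
  apply: filterS (cvgr_gt _ cgf _ gz) => y /= gy.
  by rewrite /cell_shift; case: eqP => // /eqP /w_small[gf _]; move: gy;
    rewrite ltNge gf.
apply: (@near_eq_cont _ _ _ (fun z : T * T => cell_point e (cell_coord e z.2 +
  w z.1))).
  have cg : continuous_at z (fun z : T * T => gauge e z.2).
    by apply: (@cont_comp _ _ _ _ (fun z : T * T => z.2));
      [cont|exact: gauge_cont].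
  apply: filterS (cvgr_lt _ cg _ gz) => y /= gy.
  by rewrite shift_inside //; lra.
apply: (@cont_comp _ _ _ _ (fun z : T * T => cell_coord e z.2 + w z.1));
  last exact: cell_point_cont.
apply: contD; first by apply: (@cont_comp _ _ _ _ (fun z : T * T => z.2));
  [cont|exact: cell_coord_cont].
by apply: (@cont_comp _ _ _ _ (fun z : T * T => z.1)); [cont|exact: w_cont].
Qed.

Let shift_graph_cont q : continuous q -> (forall x, good (x, q x)) ->
  continuous (fun x => cell_shift e (w x) (q x)).
Proof.
move=> cq gq x; apply: (@cont_comp _ _ _ _ (fun x => (x, q x)) (fun z : T * T
  => cell_shift e (w z.1) z.2)).
  by cont; exact: cq.
exact: shift_cont.
Qed.

Lemma continuous_shift : continuous (fun x => cell_shift e (w x) (f x)).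
Proof. exact: shift_graph_cont. Qed.

(** A map [q] close to [f] without coincidences is shifted by the same [w]. Where [w] is nonzero,
    [q] and [f] have gauge at most 3/2 and [w] has norm at most 1/2, so both shifted points stay
    within radius 2, where equal points have equal coordinates. *)
Lemma avoidable_shift : avoidable f -> avoidable (fun x => cell_shift e (w x)
  (f x)).
Proof.
move=> fav O oO Of.
pose S (z : T * T) := (z.1, cell_shift e (w z.1) z.2).
have [||q cq qP] := fav [set z | good z /\ O (S z)].
- apply: open_setP => z [gz Oz]; apply: filterI; first exact: good_near.
  have cS : continuous_at z S by rewrite /S; cont; exact: shift_cont.
  by apply: cS; apply: open_nbhs_nbhs.
- by move=> x; split; [exact: good_graph|exact: Of].
exists (fun x => cell_shift e (w x) (q x)).
  by apply: shift_graph_cont => // x; have [_ []] := qP x.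
move=> x; have [qf [gq Oq]] := qP x; split=> // qfE; apply: qf; move: qfE.
rewrite /cell_shift; case: eqP => // /eqP /w_small[g1 w2].
have gq2 : gauge e (q x) <= 3 / 2 by case: gq => /=; lra.
have norm2 b : gauge e b <= 3 / 2 -> `|cell_coord e b + w x| <= 2.
  move=> gb; apply: le_trans (ler_normD _ _) _.
  by rewrite norm_cell_coord; lra.
move=> /(congr1 (cell_coord e)); rewrite !cell_pointK ?norm2 //; last by lra.
move=> /addIr/(congr1 (cell_point e)); rewrite !cell_coordK //; lra.
Qed.

End Shift.

(** Equal to 1 up to gauge 1/2, the radius at which the cells cover, and to 0 from gauge 3/4 on. *)
Definition step_weight e (b : T) : R := Num.max 0 (Num.min 1 (3 - 4 * gauge e
  b)).

Definition cell_step e (a b : T) : T :=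
  cell_shift e (step_weight e b *: (cell_coord e b - cell_coord e a)) a.

Lemma step_weight_small e b : step_weight e b != 0 -> gauge e b < 3 / 4.
Proof.
have [//|gb] := ltP (gauge e b) (3 / 4); rewrite /step_weight max_l ?eqxx //.
by rewrite ge_min; apply/orP; right; lra.
Qed.

Lemma step_diag e b : cell_step e b b = b.
Proof. by rewrite /cell_step subrr scaler0 /cell_shift eqxx. Qed.

Lemma step_far e a b : 3 / 4 <= gauge e b -> cell_step e a b = a.
Proof.
move=> gb; rewrite /cell_step; have [->|/step_weight_small] := eqVneq
  (step_weight e b) 0.
  by rewrite scale0r /cell_shift eqxx.
by rewrite ltNge gb.
Qed.

(** Off the diagonal, [a] may lie outside the cell, where [cell_shift] can jump as the weight
    reaches 0. *)
Lemma step_cont e b : continuous_at (b, b) (fun z : T * T => cell_step e z.1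
  z.2).
Proof.
have cg1 : continuous_at (b, b) (fun z : T * T => gauge e z.1).
  by apply: (@cont_comp _ _ _ _ (fun z : T * T => z.1));
    [cont|exact: gauge_cont].
have cg2 : continuous_at (b, b) (fun z : T * T => gauge e z.2).
  by apply: (@cont_comp _ _ _ _ (fun z : T * T => z.2));
    [cont|exact: gauge_cont].
have cc1 : continuous_at (b, b) (fun z : T * T => cell_coord e z.1).
  by apply: (@cont_comp _ _ _ _ (fun z : T * T => z.1));
    [cont|exact: cell_coord_cont].
have cc2 : continuous_at (b, b) (fun z : T * T => cell_coord e z.2).
  by apply: (@cont_comp _ _ _ _ (fun z : T * T => z.2));
    [cont|exact: cell_coord_cont].
have [gb|gb] := ltP (gauge e b) 2.
  apply: (@near_eq_cont _ _ _ (fun z : T * T => cell_point e (cell_coord e z.1 +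
      step_weight e z.2 *: (cell_coord e z.2 - cell_coord e z.1)))).
    by apply: filterS (cvgr_lt _ cg1 _ gb) => y /= gy;
      rewrite /cell_step shift_inside // ltW.
  apply: (cont_comp _ (@cell_point_cont _ _ _ e _)).
  by rewrite /step_weight; cont.
apply: (@near_eq_cont _ _ _ (fun z : T * T => z.1)); last by cont.
have gb1 : 3 / 4 < gauge e b by lra.
by apply: filterS (cvgr_gt _ cg2 _ gb1) => y /= gy; rewrite step_far // ltW.
Qed.

Lemma step_end e a b : gauge e b < 2^-1 -> gauge e a <= 1 -> cell_step e a b =
  b.
Proof.
move=> gb ga; have -> : cell_step e a b = cell_point e (cell_coord e b).
  rewrite /cell_step shift_inside; last by lra.
  rewrite (_ : step_weight e b = 1) ?scale1r 1?addrC ?subrK //.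
  by rewrite /step_weight min_l ?max_r //; lra.
by rewrite cell_coordK //; lra.
Qed.

(* Wherever the cell covers [h x], one step moves [f x] onto [h x], and the
   steps in the other cells leave it there. *)
Lemma avoidable_close (L : seq (cell R T n)) :
  exists2 D : set (T * T), (forall b : T, \forall z \near (b, b), D z) &
    forall f h, continuous f -> continuous h -> (forall x, D (f x, h x)) ->
    avoidable f -> exists f', [/\ continuous f', avoidable f' &
      forall x, f x = h x \/ has (fun e => gauge e (h x) < 2^-1) L ->
        f' x = h x].
Proof.
elim: L => [|e L [D DP DL]].
  exists setT => [b|f h cf ch _ fav]; first exact: filterT.
  by exists f; split=> // x [].
pose near_cell : set (T * T) := [set z | gauge e z.2 < 3 / 4 ->
  gauge e z.1 <= 1 /\ `|cell_coord e z.2 - cell_coord e z.1| <= 2^-1].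
exists [set z | near_cell z /\ D (cell_step e z.1 z.2, z.2)].
  move=> b; apply: filterI.
    have cg1 : continuous_at (b, b) (fun z : T * T => gauge e z.1).
      by apply: (@cont_comp _ _ _ _ (fun z : T * T => z.1));
        [cont|exact: gauge_cont].
    have cg2 : continuous_at (b, b) (fun z : T * T => gauge e z.2).
      by apply: (@cont_comp _ _ _ _ (fun z : T * T => z.2));
        [cont|exact: gauge_cont].
    have cc : continuous_at (b, b) (fun z : T * T => `|cell_coord e z.2 -
      cell_coord e z.1|).
      cont.
        by apply: (@cont_comp _ _ _ _ (fun z : T * T => z.2));
          [cont|exact: cell_coord_cont].
      by apply: (@cont_comp _ _ _ _ (fun z : T * T => z.1));
        [cont|exact: cell_coord_cont].
    have [gb|gb] := ltP (gauge e b) 1.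
      near=> z => _; split; apply: ltW; near: z; first exact: (cvgr_lt _ cg1).
      by apply: (cvgr_lt _ cc); rewrite /= subrr normr0 invr_gt0.
    have gb1 : 3 / 4 < gauge e b by lra.
    by apply: filterS (cvgr_gt _ cg2 _ gb1) => z /= gz; rewrite /near_cell /=;
      lra.
  have cS : continuous_at (b, b) (fun z : T * T => (cell_step e z.1 z.2, z.2)).
    by cont; exact: step_cont.
  by apply: cS; rewrite /= step_diag; exact: DP.
move=> f h cf ch fhD fav.
pose w x := step_weight e (h x) *: (cell_coord e (h x) - cell_coord e (f x)).
have cw : continuous w.
  move=> x; rewrite /w /step_weight; cont.
  - by apply: (@cont_comp _ _ _ _ h); [exact: ch|exact: gauge_cont].
  - by apply: (@cont_comp _ _ _ _ h); [exact: ch|exact: cell_coord_cont].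
  - by apply: (@cont_comp _ _ _ _ f); [exact: cf|exact: cell_coord_cont].
have w_small x : w x != 0 -> gauge e (f x) <= 1 /\ `|w x| <= 2^-1.
  have [nc _] := fhD x.
  rewrite /w scaler_eq0 negb_or => /andP[/step_weight_small/nc/=[gf cfh] _];
    split=> //.
  apply: le_trans cfh; rewrite normrZ ler_piMl // ger0_norm.
    by rewrite ge_max ler01 ge_min lexx.
  by rewrite le_max lexx.
have cf1 := continuous_shift cf cw w_small.
have fav1 := avoidable_shift cf cw w_small fav.
have [|f' [cf' fav' f'P]] := DL _ h cf1 ch _ fav1.
  by move=> x; have [_] := fhD x.
exists f'; split=> // x fhx; apply: f'P.
have [fh|fh] := eqVneq (f x) (h x).
  by left; rewrite /w fh -[RHS](step_diag e).
case: fhx => [/eqP|/orP[gh|]]; [by rewrite (negbTE fh)|left|by right].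
have [/= nc _] := fhD x.
have gh' : gauge e (h x) < 3 / 4 by lra.
by have [/= gf _] := nc gh'; exact: step_end.
Unshelve. all: by end_near.
Qed.

Lemma avoidable_near_diag (L : seq (cell R T n)) :
  (forall x, has (fun e => gauge e x < 2^-1) L) ->
  exists2 D : set (T * T), (forall b : T, \forall z \near (b, b), D z) &
    forall f h, continuous f -> continuous h -> (forall x, D (f x, h x)) ->
    avoidable f -> avoidable h.
Proof.
move=> Lcov; have [D DP Dav] := avoidable_close L; exists D => // f h cf ch fh
  fav.
have [f' [_ fav' f'h]] := Dav f h cf ch fh fav.
by rewrite (_ : h = f') //; apply/funext => x; rewrite f'h //; right.
Qed.

(** By compactness, [H (s, x)] and [H (t, x)] are close uniformly in [x] for [s] near [t]. Both
    orders of the pair are recorded: one serves to reach [t] from an earlier time, the other to go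
    beyond [t]. *)
Lemma avoidable_homotopic (L : seq (cell R T n)) (H : R * T -> T) :
  (forall x, has (fun e => gauge e x < 2^-1) L) -> compact [set: T] ->
  continuous H -> avoidable (fun x => H (0, x)) -> avoidable (fun x => H (1,
    x)).
Proof.
move=> /avoidable_near_diag[D DP Dav] T_compact H_cont.
have cH t : continuous (fun x => H (t, x)).
  by move=> x; apply: (@cont_comp _ _ _ _ (fun x => (t, x)));
    [cont|exact: H_cont].
have close t : \forall s \near t, forall x, D (H (s, x), H (t, x)) /\ D (H (t,
  x), H (s, x)).
  have := (compact_near_coveringP _).1 T_compact R (nbhs t)
    (fun s x => D (H (s, x), H (t, x)) /\ D (H (t, x), H (s, x))) _.
  move=> /(_ _) near_cov; suff : \forall s \near t, [set: T] `<=`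
      (fun x => D (H (s, x), H (t, x)) /\ D (H (t, x), H (s, x))).
    by apply: filterS => s sP x; exact: sP.
  apply: near_cov => x _.
  have c1 : continuous_at (x, t) (fun z : T * R => H (z.2, z.1)).
    by apply: (@cont_comp _ _ _ _ (fun z : T * R => (z.2, z.1)));
      [cont|exact: H_cont].
  have c2 : continuous_at (x, t) (fun z : T * R => H (t, z.1)).
    by apply: (@cont_comp _ _ _ _ (fun z : T * R => (t, z.1)));
      [cont|exact: H_cont].
  apply: filterI.
    exact: (cont_pair c1 c2 (DP _)).
  exact: (cont_pair c2 c1 (DP _)).
move=> H0; suff : forall t, 0 <= t <= 1 -> avoidable (fun x => H (t, x)).
  by apply; rewrite lexx ler01.
apply: real_induction => t /andP[t0 t1] IH.
  have [->//|t_neq0] := eqVneq t 0.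
  have tgt0 : 0 < t by rewrite lt_neqAle eq_sym t_neq0.
  have /nbhs_ballP[d /= d0 dP] := close t.
  pose s := Num.max 0 (t - d / 2).
  have st : s < t by rewrite /s gt_max tgt0 ltrBlDr ltrDl divr_gt0.
  have s0 : 0 <= s by rewrite /s le_max lexx.
  have ds : ball t d s.
    rewrite -ball_normE /= gtr0_norm ?subr_gt0 // ltrBlDr -ltrBlDl.
    by rewrite lt_max; apply/orP; right; lra.
  by apply: (Dav (fun x => H (s, x))) => // [x|]; [have [] := dP s ds x|apply:
    IH; rewrite s0].
have /nbhs_ballP[d /= d0 dP] := close t.
exists d => // s /andP[ts std] _; apply: (Dav (fun x => H (t, x))) => // [x|].
  have ds : ball t d s.
    by rewrite -ball_normE /= distrC gtr0_norm ?subr_gt0 // ltrBlDl.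
  by have [] := dP s ds x.
by apply: IH; rewrite t0 lexx.
Qed.

(** The approximations are themselves constant, with value displaced from [x0] along a coordinate
    axis; compactness makes them fit into [O]. *)
Lemma avoidable_cst e (x0 : T) : compact [set: T] -> (0 < n)%N ->
  gauge e x0 <= 1 -> avoidable (fun=> x0).
Proof.
move=> T_compact n0 gx0 O oO Ox0.
have : \forall b \near x0, [set: T] `<=` (fun x => O (x, b)).
  apply: ((compact_near_coveringP _).1 T_compact T (nbhs x0) (fun b x => O (x,
    b))) => x _.
  have c : continuous_at (x, x0) (fun z : T * T => (z.1, z.2)) by cont.
  by apply: c; apply: open_nbhs_nbhs.
move=> Onear.
pose v : V := delta_mx ord0 (Ordinal n0).
have v_neq0 : v != 0.
  by apply/eqP => /rowP/(_ (Ordinal n0)); rewrite !mxE !eqxx; apply/eqP;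
    rewrite oner_eq0.
pose b (t : R) := cell_point e (cell_coord e x0 + t *: v).
have cb : continuous_at 0 b.
  apply: (cont_comp _ (@cell_point_cont _ _ _ e _)); by cont.
have b0 : b 0 = x0 by rewrite /b scale0r addr0 cell_coordK //; lra.
have near1 : \forall t \near (0 : R), `|cell_coord e x0 + t *: v| < 2.
  have c : continuous_at 0 (fun t : R => `|cell_coord e x0 + t *: v|) by cont.
  by apply: (cvgr_lt _ c); rewrite scale0r addr0 norm_cell_coord; lra.
have near2 : \forall t \near (0 : R), [set: T] `<=` (fun x => O (x, b t)).
  have := cb [set y | [set: T] `<=` (fun x => O (x, y))].
  by rewrite b0; apply.
have : \forall t \near (0 : R), `|cell_coord e x0 + t *: v| < 2 /\
    [set: T] `<=` (fun x => O (x, b t)) by exact: filterI.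
move=> /nbhs_ballP[d /= d0 dP].
have [] := dP (d / 2).
  by rewrite -ball_normE /= sub0r normrN gtr0_norm ?divr_gt0 //; lra.
move=> small Ob; exists (fun=> b (d / 2)); first by move=> x; exact: cont_cst.
move=> x; split; last exact: Ob.
move=> /(congr1 (cell_coord e)); rewrite /b cell_pointK; last exact: ltW.
move=> /eqP; rewrite -subr_eq0 addrAC subrr add0r scaler_eq0 (negbTE v_neq0)
  orbF.
by apply/negP; rewrite gt_eqF // divr_gt0.
Qed.

End Transport.

Theorem closed_contractible_is_point (R : realType) (T : topologicalType) (n :
  nat) :
  hausdorff_space T -> compact [set: T] ->
  (forall x : T, exists2 c : chart R T n, is_chart c & cdom c x) ->
  contractible R T -> forall x y : T, x = y.
Proof.
move=> T_hausdorff T_compact charts [H [x0 [H_cont H0 H1]]].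
have T_cells x : exists e : cell R T n, gauge e x = 0.
  by have [c cP xc] := charts x; exact: cell_of_chart xc.
suff x0E x : x = x0 by move=> x y; rewrite (x0E x) (x0E y).
have [n0|n0] := posnP n.
  suff : forall t, 0 <= t <= 1 -> H (t, x) = x.
    by move=> /(_ 1); rewrite lexx ler01 H1 => ->.
  (* In dimension 0 points are open, so the path of [x] under the contraction is locally
     constant. *)
  have single (y : T) : \forall z \near y, z = y.
    have [e ey] := T_cells y; have gy : gauge e y < 2 by rewrite ey.
    apply: filterS (cvgr_lt _ (@gauge_cont _ _ _ e y) _ gy) => z gz.
    rewrite -[LHS](cell_coordK (ltW gz)) -[RHS](cell_coordK (ltW gy));
      congr cell_point.
    by apply/rowP => i; have := ltn_ord i; rewrite {2}n0.
  have cH (t : R) : continuous_at t (fun t => H (t, x)).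
    by apply: (@cont_comp _ _ _ _ (fun t : R => (t, x))); [cont|exact: H_cont].
  have near t : \forall s \near t, H (s, x) = H (t, x).
    exact: (cH t _ (single _)).
  apply: real_induction => t /andP[t0 t1] IH.
    have [->//|t_neq0] := eqVneq t 0.
    have tgt0 : 0 < t by rewrite lt_neqAle eq_sym t_neq0.
    have /nbhs_ballP[d /= d0 dP] := near t.
    pose s := Num.max 0 (t - d / 2).
    have st : s < t by rewrite /s gt_max tgt0 ltrBlDr ltrDl divr_gt0.
    have s0 : 0 <= s by rewrite /s le_max lexx.
    rewrite -(dP s) ?IH ?s0 // -ball_normE /= gtr0_norm ?subr_gt0 // ltrBlDr
      -ltrBlDl.
    by rewrite lt_max; apply/orP; right; lra.
  have /nbhs_ballP[d /= d0 dP] := near t.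
  exists d => // s /andP[ts std] _; rewrite dP ?IH ?t0 ?lexx //.
  by rewrite -ball_normE /= distrC gtr0_norm ?subr_gt0 // ltrBlDl.
have [L Lcov] := finite_cells T_compact T_cells.
have [e ex0] := T_cells x0.
have idav : avoidable (fun x : T => x).
  have -> : (fun x : T => x) = fun x => H (1 - 1, x) by apply/funext => y;
    rewrite subrr H0.
  apply: (@avoidable_homotopic R T n L (fun z => H (1 - z.1,
    z.2)) Lcov T_compact) => /=.
    by move=> z; apply: (@cont_comp _ _ _ _ (fun z : R * T => (1 - z.1, z.2)));
      [cont|exact: H_cont].
  have -> : (fun x => H (1 - 0, x)) = fun=> x0 by apply/funext => y;
    rewrite subr0 H1.
  by apply: (avoidable_cst (e := e)); rewrite // ex0.
(* Closeness has served its purpose: any map without fixed points will do now. *)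
have [|//|q cq qx] := idav setT; first exact: openT.
have [y qy] := contractible_fixed_point H_cont H0 H1 T_compact Lcov cq.
by have [] := qx y.
Qed.

(** * Flows of vector fields *)

Section Calculus.
Variable R : realType.

Lemma is_derive_coord (V : normedModType R) n (f : V -> 'rV[R]_n) x v df j :
  is_derive x v f df -> is_derive x v (fun y => f y ord0 j) (df ord0 j).
Proof.
move=> [fx <-]; split; first exact: (derivable_mxP f x v).1.
by rewrite (derive_mx fx) mxE.
Qed.

Lemma is_derive_line (V W : normedModType R) (f : V -> W) (y u : V) (s : R) :
  differentiable f (y + s *: u) ->
  is_derive s 1 (fun t => f (y + t *: u)) ('D_u f (y + s *: u)).
Proof.
move=> df.
have E : (fun h : R => h^-1 *: (((fun t => f (y + t *: u)) \o shift s) (h *: 1)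
  - f (y + s *: u))) =
    (fun h => h^-1 *: ((f \o shift (y + s *: u)) (h *: u) - f (y + s *: u))).
  apply/funext => h /=; congr (_ *: (f _ - _)).
  by rewrite [h *: 1]mulr1 scalerDl addrCA.
split; first by rewrite /derivable E; exact: diff_derivable.
by rewrite /derive E.
Qed.

(** On a ball where the partial derivatives are bounded by [K i], the mean value theorem along
    segments, applied to each coordinate of [f], gives the constant [\sum_i K i]. *)
Lemma classC1_locally_lipschitz n m (D : set 'rV[R]_n) (f : 'rV[R]_n ->
  'rV[R]_m) p :
  open D -> classC 1 D f -> D p ->
  exists r L : R, [/\ 0 < r, 0 <= L, ball p r `<=` D &
    forall x y, ball p r x -> ball p r y -> `|f x - f y| <= L * `|x - y|].
Proof.
move=> oD [df Df] Dp.
pose ev (i : 'I_n) : 'rV[R]_n := delta_mx ord0 i.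
pose K (i : 'I_n) := `|'D_(ev i) f p| + 1.
have Knear : \forall x \near p, forall i, `|'D_(ev i) f x| < K i.
  apply: (@filter_forall _ _ (fun i x => `|'D_(ev i) f x| < K i) (nbhs p) _) =>
    i.
  have c : continuous_at p (fun x => `|'D_(ev i) f x|) by apply: cont_norm;
    exact: Df.
  by apply: (cvgr_lt _ c); rewrite ltrDl.
have : \forall x \near p, D x /\ forall i, `|'D_(ev i) f x| < K i.
  by apply: filterI => //; exact: open_nbhs_nbhs.
move=> /nbhs_ballP[r /= r0 rP].
have K0 i : 0 <= K i by rewrite addr_ge0.
exists r, (\sum_i K i); split=> // [|x /rP[]//|x y px py];
  first exact: sumr_ge0.
have seg (s : R) : 0 <= s <= 1 -> ball p r (y + s *: (x - y)).
  move=> /andP[s0 s1]; move: px py; rewrite -!ball_normE /= => px py.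
  have -> : p - (y + s *: (x - y)) = (1 - s) *: (p - y) + s *: (p - x).
    by rewrite !scalerBr !scalerBl !scale1r opprD; apply/rowP => i;
      rewrite !mxE; ring.
  apply: le_lt_trans (ler_normD _ _) _; rewrite !normrZ !ger0_norm ?subr_ge0 //.
  have [->|sneq0] := eqVneq s 0; first by rewrite subr0 mul0r mul1r addr0.
  have spos : 0 < s by rewrite lt_neqAle eq_sym sneq0.
  apply: (@lt_le_trans _ _ ((1 - s) * r + s * r));
    last by rewrite -mulrDl subrK mul1r.
  by rewrite ler_ltD // ?ltr_pM2l // ler_wpM2l ?subr_ge0 // ltW.
have Dbound z : ball p r z -> `|'D_(x - y) f z| <= (\sum_i K i) * `|x - y|.
  move=> /rP[Dz Kz]; rewrite deriveE; last exact: df.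
  rewrite [X in 'd f z X]row_sum_delta linear_sum /= mulr_suml.
  apply: le_trans (ler_norm_sum _ _ _) _; apply: ler_sum => i _.
  rewrite linearZ /= normrZ mulrC; apply: ler_pM => //;
    last exact: coord_norm_le.
  by rewrite -deriveE; [exact: ltW (Kz i)|exact: df].
apply: norm_rV_le => [|j]; first by rewrite mulr_ge0 ?sumr_ge0.
pose g (s : R) : R := f (y + s *: (x - y)) ord0 j.
have gd (s : R) : 0 <= s <= 1 -> is_derive s 1 g ('D_(x - y) f (y + s *: (x -
  y)) ord0 j).
  by move=> /seg/rP[Ds _]; exact: is_derive_coord (is_derive_line (df _ Ds)).
have [||c c01] := @MVT R g (fun s => 'D_(x - y) f (y + s *: (x - y)) ord0 j) 0
  1 ltr01.
- by move=> s; rewrite in_itv /= => /andP[s0 s1]; apply: gd; rewrite !ltW.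
- apply: derivable_within_continuous => s; rewrite in_itv /= => s01.
  by have [] := gd s s01.
have -> : g 1 = f x ord0 j by rewrite /g scale1r addrC subrK.
have -> : g 0 = f y ord0 j by rewrite /g scale0r addr0.
move=> gE; rewrite !mxE gE subr0 mulr1; apply: le_trans (coord_norm_le _ _) _.
apply: Dbound; apply: seg; move: c01; rewrite in_itv /= => /andP[? ?].
by rewrite !ltW.
Qed.

(** The function [q u * expR (- k * u)] has a nonpositive derivative. *)
Lemma gronwall (q dq : R -> R) (k s t : R) : s <= t ->
  (forall u, s <= u <= t -> is_derive u 1 q (dq u)) ->
  (forall u, s <= u <= t -> dq u <= k * q u) ->
  q t <= q s * expR (k * (t - s)).
Proof.
rewrite le_eqVlt => /predU1P[->|st] qd dqk.
  by rewrite subrr mulr0 expR0 mulr1.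
pose h := q * (fun u => expR (- k * u)).
have hd u : s <= u <= t -> is_derive u 1 h (q u *: (- k * expR (- k * u)) +
  expR (- k * u) *: dq u).
  move=> /qd qu; apply: is_deriveM.
  have dk : is_derive u 1 (fun u => - k * u) (- k).
    by have := is_deriveZ (- k) (is_derive_id u (1 : R)); rewrite [_ *: 1]mulr1.
  rewrite [X in is_derive _ _ _ X]mulrC.
  exact: is_derive1_comp (is_derive_expR (- k * u)) dk.
have [||c c01] := @MVT R h (fun u => q u *: (- k * expR (- k * u)) + expR (- k
  * u) *: dq u) s t st.
- by move=> u; rewrite in_itv /= => /andP[u0 u1]; apply: hd; rewrite !ltW.
- apply: derivable_within_continuous => u; rewrite in_itv /= => u01.
  by have [] := hd u u01.
move=> hE.
have {hE} : h t - h s <= 0.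
  rewrite hE; apply: mulr_le0_ge0; last by rewrite subr_ge0 ltW.
  have : s <= c <= t by move: c01; rewrite in_itv /= => /andP[? ?];
    rewrite !ltW.
  move=> /dqk dqc.
  rewrite (_ : _ + _ = expR (- k * c) * (dq c - k * q c)).
    by apply: mulr_ge0_le0; [exact: expR_ge0|rewrite subr_le0].
  by rewrite /GRing.scale /=; ring.
rewrite subr_le0 /h !mulrfctE => hts.
have -> : q t = q t * expR (- k * t) * expR (k * t).
  by rewrite -mulrA -expRD mulNr addNr expR0 mulr1.
apply: (@le_trans _ _ (q s * expR (- k * s) * expR (k * t))).
  by rewrite ler_wpM2r ?expR_ge0.
by rewrite -mulrA -expRD mulNr mulrBr addrC.
Qed.

(** The squared Euclidean norm: the norm of ['rV[R]_n] is the maximum norm, which is not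
    differentiable. *)
Definition sqsum n (v : 'rV[R]_n) : R := \sum_j v ord0 j * v ord0 j.

Lemma norm_sqsum n (v : 'rV[R]_n) : `|v| ^+ 2 <= sqsum v.
Proof.
have [->|] := eqVneq `|v| 0.
  by rewrite expr0n /= sumr_ge0 // => j _; rewrite -expr2 sqr_ge0.
move=> v0; have [[i j] /= vj] : exists ij : 'I_1 * 'I_n, `|v| = `|v ij.1 ij.2|.
  by have := mx_norm_neq0 v0.
rewrite vj ord1 real_normK ?num_real // /sqsum (bigD1 j) //= expr2 lerDl.
by apply: sumr_ge0 => k _; rewrite -expr2 sqr_ge0.
Qed.

Lemma sqsum_cont n : continuous (@sqsum n).
Proof. by move=> v; rewrite /sqsum; apply: cont_sum => i; cont. Qed.

(** Each of the [n] terms of the derivative of [sqsum (a - b)] is at most [2 * L] times the squared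
    maximum norm, which [sqsum] bounds from above; then Gronwall's inequality applies. *)
Lemma lipschitz_ode_close n (f : 'rV[R]_n -> 'rV[R]_n) (D : set 'rV[R]_n) (L s
  t : R)
    (a b : R -> 'rV[R]_n) : s <= t -> 0 <= L ->
  (forall x y, D x -> D y -> `|f x - f y| <= L * `|x - y|) ->
  (forall u, s <= u <= t -> is_derive u 1 a (f (a u)) /\ D (a u)) ->
  (forall u, s <= u <= t -> is_derive u 1 b (f (b u)) /\ D (b u)) ->
  sqsum (a t - b t) <= sqsum (a s - b s) * expR (n%:R * 2 * L * (t - s)).
Proof.
move=> st L0 lip da db.
pose d j u := a u ord0 j - b u ord0 j.
pose dq u := \sum_j (d j u * (f (a u) - f (b u)) ord0 j + d j u * (f (a u) - f
  (b u)) ord0 j).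
have qE : (fun u => sqsum (a u - b u)) = \sum_j (d j * d j).
  apply/funext => u; rewrite fct_sumE; apply: eq_bigr => j _.
  by rewrite !mxE.
apply: (@gronwall (fun u => sqsum (a u - b u)) dq) => // u /[dup] /da[dau Da]
  /db[dbu Db].
  rewrite qE; apply: is_derive_sum => j.
  have dj : is_derive u 1 (d j) ((f (a u) - f (b u)) ord0 j).
    rewrite !mxE; apply: is_deriveB; exact: is_derive_coord.
  exact: is_deriveM.
have N0 := norm_sqsum (a u - b u).
apply: (@le_trans _ _ (\sum_(j < n) (2 * L * `|a u - b u| ^+ 2))); last first.
  rewrite sumr_const card_ord -[leLHS]mulr_natl !mulrA.
  rewrite -[leLHS]mulrA -expr2; by apply: ler_wpM2l => //; rewrite !mulr_ge0.
rewrite /dq; apply: ler_sum => j _; rewrite -mulr2n -[leLHS]mulr_natl -mulrA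
  ler_wpM2l //.
apply: le_trans (ler_norm _) _; rewrite normrM expr2 mulrCA ler_pM //.
  by have := coord_norm_le (a u - b u) j; rewrite !mxE.
by apply: le_trans (coord_norm_le _ _) _; exact: lip.
Qed.

End Calculus.

(** * Dependence of solutions on the initial point *)

Section Flow.
Variables (R : realType) (X : chartedSpace R).
Hypothesis X_manifold : smooth_manifold X.
Variable F : forall x : X, tangent x.
Hypothesis F_smooth : @smooth_along R X X setT id F.

Local Notation V := 'rV[R]_(dim X).

Definition field_in (c : chart R X (dim X)) (v : V) : V := coord (F (cinv c v))
  c.

Lemma field_inE c x : atlas X c -> cdom c x -> field_in c (c x) = coord (F x) c.
Proof.
by move=> /(manifold_charts X_manifold) cP xc; rewrite /field_in (chartK cP xc).
Qed.

Lemma lipschitz_chart (x : X) : exists c r L, [/\ atlas X c, cdom c x,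
    0 < r /\ 0 <= L, ball (c x) r `<=` c @` cdom c &
    forall v w, ball (c x) r v -> ball (c x) r w ->
      `|field_in c v - field_in c w| <= L * `|v - w|].
Proof.
have [c Xc xc] := manifold_cover X_manifold x.
have cP := manifold_charts X_manifold Xc.
have [_ /(_ c (Chart setT id id) Xc erefl 1%N)] := F_smooth Xc.
rewrite (_ : (_ @` _) = c @` cdom c); last first.
  by congr (_ @` _); apply/seteqP; split=> y /= => [[[]]|].
move=> sm; have := @classC1_locally_lipschitz R _ _ (c @` cdom c) (field_in c)
  (c x).
case=> [|||r [L [r0 L0 rD lip]]].
- exact: chart_open_img.
- exact: sm.
- by exists x.
by exists c, r, L.
Qed.

(** Closed in all of [X], as the image of a compact ball in a Hausdorff space. So a curve that is in
    this set at all earlier times cannot have left the chart at the next instant. *)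
Lemma closed_chart_ball c (x : X) (r : R) : atlas X c ->
  [set v | `|v - c x| <= r] `<=` c @` cdom c ->
  closed [set y | cdom c y /\ `|c y - c x| <= r].
Proof.
move=> /(manifold_charts X_manifold) cP rD.
have -> : [set y | cdom c y /\ `|c y - c x| <= r] =
    cinv c @` [set v | `|v - c x| <= r].
  apply/seteqP; split=> y /= => [[yc yr]|[v vr <-]].
    by exists (c y) => //; exact: chartK.
  by have [z zc zv] := rD v vr; rewrite -zv (chartK cP zc) zv.
apply: compact_closed; first exact: manifold_hausdorff.
apply: continuous_compact.
  apply: continuous_in_subspaceT => v; rewrite inE /= => /rD vD.
  exact: chart_inv_continuous.
have -> : [set v | `|v - c x| <= r] = (fun w => w + c x) @` [set w : V | `|w|
  <= r].
  apply/seteqP; split=> v /= => [vr|[w wr <-]]; last by rewrite addrK.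
  by exists (v - c x); rewrite // subrK.
apply: continuous_compact; last exact: compact_norm_le.
by apply: continuous_subspaceT => v; cont.
Qed.

Section Tracking.
Variables (Z : Type) (G : set_system Z) (Gamma : Z -> R -> X) (gamma : R -> X).
Hypothesis G_filter : Filter G.
Hypothesis Gamma_curve : forall z (t : R), 0 <= t -> integral_curve_at F (Gamma
  z) t.
Hypothesis gamma_curve : forall t : R, 0 <= t -> integral_curve_at F gamma t.

(* [tracks t]: the curves [Gamma z] converge to [gamma] at time [t] along the
   filter [G].  A filter of neighbourhoods gives continuous dependence on the
   initial point, a trivial one gives uniqueness. *)
Definition tracks t := forall O, nbhs (gamma t) O -> \forall z \near G,
  O (Gamma z t).

(** Convergence jointly in the curve and in time, as joint continuity of the flow requires; only
    nonnegative times count, since [Gamma_curve] speaks of no others. *)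
Definition tracks_near t := forall O, nbhs (gamma t) O ->
  \forall z \near G & s \near t, 0 <= s -> O (Gamma z s).

Lemma tracks_nearW t : 0 <= t -> tracks_near t -> tracks t.
Proof.
move=> t0 tn O /tn[[A B] /= [GA tB] ABO]; apply: filterS GA => z Az.
by apply: (ABO (z, t)) => //; split=> //=; exact: nbhs_singleton.
Qed.

(** In a chart around [gamma tau], [gamma] stays within [r / 4] of the centre, and curves within
    [r / 4] of [gamma] stay in the ball of radius [r / 2], where the field is Lipschitz. Strictness
    of [s < t] puts all times near [t] after [s]; at [s = 0] the restriction to nonnegative times
    does so. *)
Lemma tracks_local (tau : R) : 0 <= tau -> exists2 eta : R, 0 < eta &
  forall s t : R, 0 <= s -> ball tau eta s -> ball tau eta t -> s = 0 /\ 0 <= t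
    \/ s < t ->
  tracks s -> tracks_near t.
Proof.
move=> tau0; have [gcont _] := gamma_curve tau0.
have [c [r [L [Xc z0c [r0 L0] rD lip]]]] := lipschitz_chart (gamma tau).
set v0 := c (gamma tau) in rD lip.
have cP := manifold_charts X_manifold Xc.
have dom_near y : cdom c y -> \forall z \near y, cdom c z.
  by move=> yc; apply: open_nbhs_nbhs; split=> //; exact: chart_open_dom.
have cc y : cdom c y -> continuous_at y c by exact: chart_continuous.
have : \forall s \near tau, cdom c (gamma s) /\ `|c (gamma s) - v0| < r / 4.
  have : \forall y \near gamma tau, cdom c y /\ `|c y - v0| < r / 4.
    apply: filterI; first exact: dom_near.
    have c1 : continuous_at (gamma tau) (fun y => `|c y - v0|) by cont;
      exact: cc.
    by apply: (cvgr_lt _ c1); rewrite subrr normr0 divr_gt0.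
  exact: gcont.
move=> /nbhs_ballP[eta /= eta0 etaP].
exists eta => // s t s0 tau_s tau_t st strk O Ot.
have [gsc gsv] := etaP s tau_s; have [gtc gtv] := etaP t tau_t.
pose K := [set y | cdom c y /\ `|c y - v0| <= r / 2].
have clK : closed K.
  apply: closed_chart_ball => // v /= vr; apply: rD;
    rewrite -ball_normE /= distrC.
  by apply: le_lt_trans vr _; lra.
pose k := (dim X)%:R * 2 * L.
have k0 : 0 <= k by rewrite !mulr_ge0.
have tube (d : R) : 0 < d -> d <= r / 4 -> \forall z \near G, forall u,
  s <= u -> u < tau + eta ->
    cdom c (Gamma z u) /\ `|c (Gamma z u) - c (gamma u)| < d.
  move=> d0 dr.
  (* Bounds the growth factor: all times concerned lie in an interval of length [2 * eta]. *)
  pose E := expR (k * (2 * eta)).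
  have start : \forall y \near gamma s, cdom c y /\ sqsum (c y - c (gamma s)) *
    E < d ^+ 2.
    apply: filterI; first exact: dom_near.
    have c1 : continuous_at (gamma s) (fun y => sqsum (c y - c (gamma s)) * E).
      cont; apply: (@cont_comp _ _ _ _ (fun y => c y - c (gamma s)) (@sqsum R
        _)).
        by cont; exact: cc.
      exact: sqsum_cont.
    apply: (cvgr_lt _ c1); rewrite subrr (_ : sqsum _ = 0) ?mul0r ?exprn_gt0 //.
    by rewrite /sqsum big1 // => j _; rewrite mxE mul0r.
  apply: filterS (strk _ start) => z [zsc zsE] u0 su0 u0eta.
  have tau_u u : s <= u -> u < tau + eta -> ball tau eta u.
    move: tau_s; rewrite -!ball_normE /= !ltr_distlC => /andP[s1 s2] su ->.
    by rewrite (lt_le_trans s1 su).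
  (* Closeness to [gamma] comes from Gronwall's inequality as long as the curve is in [K], and the
     curve is in [K] as long as it is close to [gamma]; real induction on the elapsed time [t']
     breaks the circle. *)
  pose P t' := cdom c (Gamma z (s + t')) /\ `|c (Gamma z (s + t')) - c (gamma
    (s + t'))| < d.
  have inK t' : 0 <= t' -> s + t' < tau + eta -> P t' -> K (Gamma z (s + t')).
    move=> t'0 t'eta [zc zd]; split=> //.
    have [|_ gv] := etaP (s + t'); first by apply: tau_u => //; rewrite lerDl.
    rewrite -(subrK (c (gamma (s + t'))) (c (Gamma z _))) -addrA.
    apply: le_trans (ler_normD _ _) _; lra.
  have KD y : K y -> ball v0 r (c y).
    by case=> yc yr; rewrite -ball_normE /= distrC (le_lt_trans yr) //; lra.
  have close t' : 0 <= t' -> s + t' < tau + eta ->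
      (forall v, s <= v <= s + t' -> K (Gamma z v)) ->
      `|c (Gamma z (s + t')) - c (gamma (s + t'))| < d.
    move=> t'0 t'eta Kv.
    have ode (eta' : R -> X) v : 0 <= v -> cdom c (eta' v) -> integral_curve_at
      F eta' v ->
        is_derive v 1 (c \o eta') (field_in c ((c \o eta') v)).
      by move=> v'0 vc [_ /(_ c Xc vc)]; rewrite /= field_inE.
    have : sqsum (c (Gamma z (s + t')) - c (gamma (s + t'))) < d ^+ 2.
      apply: le_lt_trans zsE.
      have := @lipschitz_ode_close R _ (field_in c) (ball v0 r) L s (s + t')
        (c \o Gamma z) (c \o gamma).
      move=> /(_ _ L0 lip) H; apply: le_trans (H _ _ _) _.
      - by rewrite lerDl.
      - move=> v sv; have [vc vr] := Kv v sv; have v'0 : 0 <= v by case/andP: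
        sv; lra.
        by split; [apply: ode => //; exact: Gamma_curve|apply: KD; exact: Kv].
      - move=> v /andP[sv vt]; have v'0 : 0 <= v by lra.
        have [|vc vr] := etaP v; first by apply: tau_u => //; lra.
        split; first by apply: ode => //; exact: gamma_curve.
        by apply: KD; split=> //; lra.
      rewrite /= ler_wpM2l ?sumr_ge0 // => [j _|];
        first by rewrite -expr2 sqr_ge0.
      rewrite ler_expR ler_wpM2l // addrAC subrr add0r.
      move: tau_s; rewrite -ball_normE /= ltr_distlC => /andP[]; lra.
    move=> sq; have := le_lt_trans (norm_sqsum _) sq.
    by rewrite ltr_pXn2r // ?nnegrE ?normr_ge0 ?(ltW d0).
  suff : P (u0 - s) by rewrite /P addrC subrK.
  apply: (@real_induction R P (u0 - s)); last by rewrite subr_ge0 su0 lexx.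
    move=> t' /andP[t'0 t'u] IH.
    have t'eta : s + t' < tau + eta by lra.
    have Kt' : K (Gamma z (s + t')).
      have [->|t'_neq0] := eqVneq t' 0.
        apply: inK => //; first by lra.
        split; rewrite addr0 //.
        have : sqsum (c (Gamma z s) - c (gamma s)) < d ^+ 2.
          apply: le_lt_trans zsE; rewrite ler_peMr ?sumr_ge0 // => [j _|].
            by rewrite -expr2 sqr_ge0.
          by rewrite -expR0 ler_expR !mulr_ge0 // ltW.
        move=> sq; have := le_lt_trans (norm_sqsum _) sq.
        by rewrite ltr_pXn2r // ?nnegrE ?normr_ge0 ?(ltW d0).
      have t'gt0 : 0 < t' by rewrite lt_neqAle eq_sym t'_neq0.
      apply: contrapT => nK.
      have [zcont _] := @Gamma_curve z (s + t') (addr_ge0 s0 t'0).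
      have : \forall y \near Gamma z (s + t'), ~ K y.
        by apply: open_nbhs_nbhs; split=> //; exact: closed_openC.
      move=> /zcont/nbhs_ballP[h /= h0 hP].
      pose v := Num.max 0 (t' - h / 2).
      have vt : v < t' by rewrite /v gt_max t'gt0 ltrBlDr ltrDl divr_gt0.
      have v'0 : 0 <= v by rewrite /v le_max lexx.
      have vh : t' - h / 2 <= v by rewrite /v le_max lexx orbT.
      apply: (hP (s + v)); last by apply: inK => //; [lra|apply: IH;
        rewrite v'0].
      rewrite -ball_normE /= gtr0_norm; lra.
    split; first by case: Kt'.
    apply: close => // v /andP[sv vt].
    have [->//|vneq] := eqVneq v (s + t').
    have vlt : v < s + t' by rewrite lt_neqAle vneq.
    have -> : v = s + (v - s) by rewrite addrC subrK.
    by apply: inK; [lra|lra|apply: IH; lra].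
  move=> t' /andP[t'0 t'u] IH.
  have [zc zd] : P t' by apply: IH; rewrite t'0 lexx.
  have t'eta : s + t' < tau + eta by lra.
  have st'0 : 0 <= s + t' by rewrite addr_ge0.
  have [zcont _] := @Gamma_curve z (s + t') st'0.
  have [gcont' _] := gamma_curve st'0.
  have [|gc _] := etaP (s + t'); first by apply: tau_u => //; rewrite lerDl.
  have : \forall v \near s + t', cdom c (Gamma z v) /\ `|c (Gamma z v) - c
    (gamma v)| < d.
    apply: filterI; first by apply: zcont; exact: dom_near.
    have c1 : continuous_at (s + t') (fun v => `|c (Gamma z v) - c (gamma v)|).
      by cont; [apply: (@cont_comp _ _ _ _ (Gamma z) c)|apply: (@cont_comp _ _
        _ _ gamma c)] => //; exact: cc.
    exact: (cvgr_lt _ c1).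
  move=> /nbhs_ballP[h /= h0 hP]; exists h => // v /andP[tv vh] _.
  by apply: hP; rewrite -ball_normE /= ltr0_norm; lra.
have w0K : `|c (gamma t) - v0| < r / 4 by [].
have cinv_cont : continuous_at (c (gamma t)) (cinv c).
  by apply: (chart_inv_continuous cP); exists (gamma t).
have : nbhs (c (gamma t)) (cinv c @^-1` O).
  by apply: cinv_cont; rewrite (chartK cP gtc).
move=> /nbhs_ballP[d1 /= d10 d1P].
pose d := Num.min (r / 4) (d1 / 2).
have d0 : 0 < d by rewrite /d lt_min !divr_gt0.
have dr : d <= r / 4 by rewrite /d ge_min lexx.
have dd1 : d <= d1 / 2 by rewrite /d ge_min lexx orbT.
have t0 : 0 <= t by case: st => [[]//|/ltW]; exact: le_trans.
have [gtcont _] := gamma_curve t0.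
have near_t : \forall u \near t, [/\ `|c (gamma u) - c (gamma t)| < d1 / 2,
  u < tau + eta &
    0 <= u -> s <= u].
  have c1 : continuous_at t (fun u => `|c (gamma u) - c (gamma t)|).
    by cont; apply: (@cont_comp _ _ _ _ gamma c) => //; exact: cc.
  have c2 : continuous_at t (fun u : R => u) by exact: cont_id.
  have c3 : \forall u \near t, 0 <= u -> s <= u.
    case: st => [[s00 _]|st]; first by apply: (@nearW _ (nbhs t)) => u;
      rewrite s00.
    by apply: filterS (cvgr_gt _ c2 _ st) => u /ltW.
  have c4 : t < tau + eta.
    by move: tau_t; rewrite -ball_normE /= ltr_distlC => /andP[].
  near=> u; split; near: u => //; last exact: (cvgr_lt _ c2).
  by apply: (cvgr_lt _ c1); rewrite subrr normr0 divr_gt0.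
exists ([set z | forall u, s <= u -> u < tau + eta ->
    cdom c (Gamma z u) /\ `|c (Gamma z u) - c (gamma u)| < d],
  [set u | [/\ `|c (gamma u) - c (gamma t)| < d1 / 2, u < tau + eta & 0 <= u ->
    s <= u]]).
  by split=> //; exact: tube.
move=> [z u] /= [zP [gu ueta /[apply] su]]; have [zc zd] := zP u su ueta.
rewrite -(chartK cP zc); apply: d1P; rewrite -ball_normE /= distrC.
rewrite -(subrK (c (gamma u)) (c (Gamma z _))) -addrA.
apply: le_lt_trans (ler_normD _ _) _; lra.
Unshelve. all: by end_near.
Qed.

(** Since [eta] depends on [tau] only and not on the starting time, [tracks_local] gives both steps
    of the real induction: from an earlier time to [t], and from [t] onwards. *)
Theorem tracks_forward : tracks 0 -> forall t : R, 0 <= t -> tracks_near t.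
Proof.
move=> trk0 T T0; suff : forall t : R, 0 <= t <= T -> tracks_near t.
  by apply; rewrite T0 lexx.
apply: real_induction => t /andP[t0 tT] IH.
  have [eta eta0 loc] := tracks_local t0.
  have [tE|t_neq0] := eqVneq t 0.
    by apply: (loc 0 t); rewrite ?tE //; [exact: ballxx|exact: ballxx|left].
  have tgt0 : 0 < t by rewrite lt_neqAle eq_sym t_neq0.
  pose s := Num.max 0 (t - eta / 2).
  have st : s < t by rewrite /s gt_max tgt0 ltrBlDr ltrDl divr_gt0.
  have s0 : 0 <= s by rewrite /s le_max lexx.
  have ts : t - eta / 2 <= s by rewrite /s le_max lexx orbT.
  apply: (loc s t) => //; [|exact: ballxx|by right|].
    by rewrite -ball_normE /= gtr0_norm; lra.
  by apply: tracks_nearW => //; apply: IH; rewrite s0.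
have [eta eta0 loc] := tracks_local t0.
exists eta => // s /andP[ts seta] _.
apply: (loc t s) => //; [exact: ballxx| |by right|].
  by rewrite -ball_normE /= ltr0_norm; lra.
by apply: tracks_nearW => //; apply: IH; rewrite t0 lexx.
Qed.

End Tracking.

(** For the filter on one point, tracking says that [b t] lies in every neighbourhood of [a t]. *)
Lemma integral_curve_unique (a b : R -> X) :
  (forall t : R, 0 <= t -> integral_curve_at F a t) ->
  (forall t : R, 0 <= t -> integral_curve_at F b t) ->
  a 0 = b 0 -> forall t : R, 0 <= t -> a t = b t.
Proof.
move=> aF bF ab t t0; apply/esym/(manifold_hausdorff X_manifold) => A B Ab Ba.
have trk0 : tracks (globally [set: unit]) (fun=> b) a 0.
  by move=> O; rewrite ab => /nbhs_singleton Ob; exact: nearW.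
have GF : Filter (globally [set: unit]) by exact: globally_filter.
have Bb := tracks_nearW GF t0 (tracks_forward GF (fun=> bF) aF trk0 t0) Ba.
by exists (b t); split; [exact: nbhs_singleton|exact: (Bb tt)].
Qed.

(** Clamping the time at 0 gives a map that is continuous on all of [R * Y], as [contractible] asks
    of a homotopy. *)
Lemma flow_continuous (Y : topologicalType) (Gamma : Y -> R -> X) :
  (forall y (t : R), 0 <= t -> integral_curve_at F (Gamma y) t) ->
  continuous (Gamma ^~ 0) ->
  continuous (fun z : R * Y => Gamma z.2 (Num.max 0 z.1)).
Proof.
move=> curve cont0 [t y] O /= Ot.
have trk0 : tracks (nbhs y) Gamma (Gamma y) 0 by move=> O'; exact: cont0.
have m0 : 0 <= Num.max 0 t by rewrite le_max lexx.
have trk := tracks_forward _ curve (curve y) trk0 m0 Ot.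
have c : continuous_at (t, y) (fun z : R * Y => (z.2, Num.max 0 z.1)) by cont.
have trk' : \forall w \near (y, Num.max 0 t), 0 <= w.2 -> O (Gamma w.1 w.2) by
  exact: trk.
have : \forall z \near (t, y), 0 <= Num.max 0 z.1 -> O (Gamma z.2 (Num.max 0
  z.1)).
  exact: c _ trk'.
apply: (@filterS _ (nbhs (t, y))) => z; apply; by rewrite le_max lexx.
Qed.

End Flow.

Lemma is_derive_shift (R : realType) (W : normedModType R) (g : R ->
  W) (a t : R) dg :
  is_derive (t + a) 1 g dg -> is_derive t 1 (fun s => g (s + a)) dg.
Proof.
have E : (fun h : R => h^-1 *: (((fun s => g (s + a)) \o shift t) (h *: 1) - g
  (t + a))) =
    (fun h => h^-1 *: ((g \o shift (t + a)) (h *: 1) - g (t + a))).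
  by apply/funext => h /=; rewrite addrA.
by move=> [dg1 dg2]; split; [rewrite /derivable E|rewrite /derive E].
Qed.

Lemma integral_curve_shift (R : realType) (X : chartedSpace R)
    (F : forall x : X, tangent x) (gamma : R -> X) (a t : R) :
  integral_curve_at F gamma (t + a) ->
  integral_curve_at F (fun s => gamma (s + a)) t.
Proof.
move=> [gc gd]; split.
  by apply: (@cont_comp _ _ _ _ (fun s => s + a) gamma); [cont|exact: gc].
by move=> c Xc tc; apply: (is_derive_shift (gd c Xc tc)).
Qed.

(** [semiflow_on] merely selects a solution for each initial point; both sides are solutions with
    the same initial point. *)
Lemma semiflow_add (R : realType) (X : chartedSpace R)
    (F : forall x : X, tangent x) (A : set X) (Phi : R -> X -> X) :
  smooth_manifold X -> @smooth_along R X X setT id F -> semiflow_on F A Phi ->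
  forall y (s t : R), A y -> 0 <= s -> 0 <= t -> Phi (t + s) y = Phi t (Phi s
    y).
Proof.
move=> X_manifold F_smooth flow y s t Ay s0 t0.
have [_ yflow] := flow y Ay; have [As _] := yflow s s0.
have [Phi0 sflow] := flow _ As.
apply: (integral_curve_unique X_manifold F_smooth (a := fun t => Phi (t + s) y)
  (b := fun t => Phi t (Phi s y))) => // [u u0|u u0|].
- apply: (integral_curve_shift (gamma := Phi ^~ y)).
  by have [] := yflow (u + s) (addr_ge0 u0 s0).
- by have [] := sflow u u0.
- by rewrite add0r Phi0.
Qed.

(** * From a section in the basin of attraction to a contraction of the base *)

Section Slice.
Variables (R : realType) (M E : chartedSpace R) (p : E -> M) (j : M -> E).
Variables (F : forall z : E, tangent z) (A N : set E) (xs : M).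
Hypotheses (M_manifold : smooth_manifold M) (M_compact : compact [set: M]).
Hypotheses (E_manifold : smooth_manifold E) (F_smooth : @smooth_along R E E
  setT id F).
Hypotheses (p_cont : continuous p) (j_cont : continuous j).
Hypotheses (jK : forall x, p (j x) = x) (jA : forall x, A (j x)).
Hypotheses (N_fibre : forall z, N z -> p z = xs).

(* Transported by the flow, the section [j] ends in a ball around [xs]. *)
Lemma contractible_of_section :
  globally_asymptotically_stable F A N -> contractible R M.
Proof.
move=> [NA [Phi [flow stable attr]]].
have curve x (t : R) : 0 <= t -> integral_curve_at F (Phi ^~ (j x)) t.
  by move=> t0; have [_ /(_ t t0)[]] := flow _ (jA x).
have Phi0 x : Phi 0 (j x) = j x by have [] := flow _ (jA x).
have Psi_cont : continuous (fun z : R * M => Phi (Num.max 0 z.1) (j z.2)).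
  apply: (flow_continuous E_manifold F_smooth (Gamma := fun x t =>
    Phi t (j x))) => //.
  by move=> x; apply: (eq_cont (f := j)) => [y|]; [rewrite Phi0|exact: j_cont].
have [c Mc xsc] := manifold_cover M_manifold xs.
have [e ge] := cell_of_chart (manifold_hausdorff M_manifold)
  (manifold_charts M_manifold Mc) xsc.
have near_fibre z : N z -> \forall y \near z, gauge e (p y) < 1.
  move=> /N_fibre zxs; have cg : continuous_at z (fun y => gauge e (p y)).
    by apply: (@cont_comp _ _ _ _ p); [exact: p_cont|exact: gauge_cont].
  by apply: (cvgr_lt _ cg); rewrite zxs ge.
have [V2 NV2 V2P] := stable [set y | gauge e (p y) < 1] near_fibre.
have [T [T0 TP]] : exists T : R, 0 <= T /\ forall x, gauge e (p (Phi T (j x)))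
  < 1.
  suff : \forall t \near +oo, [set: M] `<=` (fun x => gauge e (p (Phi t (j x)))
    < 1).
    move=> near_oo.
    have : \forall t \near +oo, 0 <= t /\ forall x, gauge e (p (Phi t (j x))) <
      1.
      near=> t; split; first by near: t; exact: nbhs_pinfty_ge.
      have H : [set: M] `<=` (fun x => gauge e (p (Phi t (j x))) < 1) by near:
        t.
      by move=> x; exact: H.
    by move=> /filter_ex[T]; exists T.
  (* Attraction brings the orbit of [j x] into [V2] at some time [t]. Continuity extends this to
     nearby starting points, and stability keeps their orbits over the ball at all times after [t];
     compactness then makes the time uniform. *)
  apply: ((compact_near_coveringP _).1 M_compact R (+oo : set_system R)
    (fun t x => gauge e (p (Phi t (j x))) < 1)) => x _.
  (* The interior is taken so that membership at time [t] persists under small changes of the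
     starting point. *)
  have NV2' : set_nbhs N V2° by move=> z /NV2; exact: nbhs_interior.
  have : \forall t \near +oo, 0 <= t /\ V2° (Phi t (j x)).
    near=> t; split; first by near: t; exact: nbhs_pinfty_ge.
    by near: t; exact: (attr _ (jA x) _ NV2').
  move=> /filter_ex[t [t0 tV2]].
  have near_x : \forall y \near x, V2 (Phi t (j y)).
    have ct : continuous_at x (fun y => Phi (Num.max 0 t) (j y)).
      apply: (@cont_comp _ _ _ _ (fun y => (t, y)) (fun z : R * M =>
        Phi (Num.max 0 z.1) (j z.2))).
        by cont.
      exact: Psi_cont.
    by move: ct; rewrite max_r // => ct; exact: ct.
  exists ([set y | V2 (Phi t (j y))], [set s | t <= s]) => /=.
    by split=> //; apply: nbhs_pinfty_ge; exact: num_real.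
  move=> [y s] /= [yV2 ts].
  have -> : s = (s - t) + t by rewrite subrK.
  rewrite (semiflow_add E_manifold F_smooth flow) ?subr_ge0 //.
  apply: V2P => //; last by rewrite subr_ge0.
  by have [_ /(_ t t0)[]] := flow _ (jA y).
(* Each phase takes half of the unit interval: the flow runs up to time [T], then the coordinates
   are scaled from 1 down to 0. *)
pose flow_phase (z : R * M) := p (Phi (Num.max 0 (T * (2 * z.1))) (j z.2)).
pose ball_phase (z : R * M) :=
  cell_point e ((2 - 2 * z.1) *: cell_coord e (p (Phi (Num.max 0 T) (j z.2)))).
exists (fun z => if 2 * z.1 <= 1 then flow_phase z else ball_phase z),
  (cell_point e 0).
split=> [|x|x].
- apply: (@cont_paste _ _ _ (fun z : R * M => 2 * z.1)).
  + by move=> z; cont.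
  + move=> z; apply: (@cont_comp _ _ _ _ (fun z : R * M => Phi (Num.max 0 (T *
    (2 * z.1))) (j z.2)) p); last exact: p_cont.
    apply: (@cont_comp _ _ _ _ (fun z : R * M => (T * (2 * z.1), z.2))
      (fun z : R * M => Phi (Num.max 0 z.1) (j z.2))); first by cont.
    exact: Psi_cont.
  + move=> z; apply: (cont_comp _ (@cell_point_cont _ _ _ e _)); cont.
    apply: (@cont_comp _ _ _ _ (fun z : R * M => p (Phi (Num.max 0 T) (j
      z.2)))); last exact: cell_coord_cont.
    apply: (@cont_comp _ _ _ _ (fun z : R * M => Phi (Num.max 0 T) (j z.2)) p);
      last exact: p_cont.
    apply: (@cont_comp _ _ _ _ (fun z : R * M => (T, z.2))
      (fun z : R * M => Phi (Num.max 0 z.1) (j z.2))); first by cont.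
    exact: Psi_cont.
  move=> [t x] /= t1; rewrite /flow_phase /ball_phase /= t1 mulr1.
  rewrite (_ : 2 - 1 = 1) ?scale1r; last by lra.
  rewrite cell_coordK // max_r // ltW // (lt_trans (TP x)) //; lra.
- by rewrite /= mulr0 ler01 /flow_phase /= !mulr0 max_l // Phi0 jK.
- rewrite /= mulr1 ifN; last by rewrite -ltNge; lra.
  by rewrite /ball_phase /= mulr1 subrr scale0r.
Unshelve. all: by end_near.
Qed.
End Slice.

Local Close Scope ring_scope.

Theorem theorem2 (R : realType) (M U : chartedSpace R)
    (M_manifold : smooth_manifold M) (M_closed : compact [set: M])
    (U_manifold : smooth_manifold U)
    (f : forall xu : M * U, tangent xu.1) (f_smooth : control_system f)
    (xs : M)
    (M_not_point : exists x : M, x <> xs)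
    (U_not_point : exists u v : U, u <> v)
    (D : dynamic_feedback f) :
  weakly_one_point_ag_stabilizes D xs \/ strongly_one_point_ag_stabilizes D xs
    ->
  ~ trivial_bundle U (proj D).
Proof.
move=> stab [phi [_ [k [[phi_smooth k_smooth] _ _ phiK kK]] fst_phi]].
(* Both notions of stabilization give a stable set contained in the fibre over [xs], and nothing
   else about it is used. *)
have [z1 [N [N_fibre N_stable]]] : exists z1 N, (forall z, N z ->
  proj D z = xs) /\
    globally_asymptotically_stable (closed_loop D) (~` [set z1]) N.
  case: stab => [[z1 st]|[z1 [zs [pzs _ st]]]].
    by exists z1, (proj D @^-1` [set xs]).
  by exists z1, [set zs]; split=> // z ->.
have bundle := feedback_bundle D.
(* The slice at height [u] misses the removed point because [u] differs from its fibre
   coordinate. *)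
have [u u1] : exists u, u <> (phi z1).2.
  have [u [v uv]] := U_not_point.
  have [uz|] := pselect (u = (phi z1).2); last by exists u.
  by exists v => vz; apply: uv; rewrite uz vz.
have kB x : (setT `*` setT) (x, u) by [].
(* The contradiction is reached by identifying a second point [x] of [M] with [xs]. *)
have [x xxs] := M_not_point; apply: xxs.
apply: (@closed_contractible_is_point R M (dim M)) => //.
- exact: manifold_hausdorff.
- move=> y; have [c Mc yc] := manifold_cover M_manifold y.
  by exists c => //; exact: manifold_charts Mc.
apply: (@contractible_of_section R M (total D) (proj D) (fun x => k (x, u))
  (closed_loop D) (~` [set z1]) N xs) => //.
- exact: bundle_total bundle.
- exact: feedback_smooth.
- by move=> z; apply: (bundle_smooth bundle).1.
- move=> y; apply: (@cont_comp _ _ _ _ (fun y => (y, u)) k); first by cont.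
  exact: k_smooth.1.
- by move=> y; rewrite -fst_phi // kK.
- by move=> y /= kz1; apply: u1; rewrite -kz1 kK.
Qed.
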